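(* Let $0<q<1$ and let $a,b,c,d\in\mathbb{C}$ with $a\neq0$ and $\max\{|a|,|b|,|c|,|d|\}<1$. Let $\mathscr{L}_q\colon\mathbb{C}[x]\to\mathbb{C}$ be the linear functional associated with the orthogonality measure of the Askey-Wilson polynomials, and let $a_j=(q^{-j}/a+aq^j)/2$ for $j\ge0$. Then, as formal power series in $u$, $$\sum_{n=0}^\infty\mathscr{L}_q(x^n)\,u^n=\sum_{n=0}^\infty\frac{(ab,ac,ad;q)_n}{(abcd;q)_n}\,\frac{(-1)^n(2a)^{-n}q^{-\binom n2}u^n}{(1-a_0u)(1-a_1u)\cdots(1-a_nu)}.$$
   Context: Notation: $(x;q)_n=\prod_{k=0}^{n-1}(1-xq^k)$ for $n\in\mathbb{N}\cup\{\infty\}$, and $(x_1,\dots,x_r;q)_n=\prod_{j}(x_j;q)_n$. The functional $\mathscr{L}_q$ is given by $$\mathscr{L}_q(x^n)=\frac{1}{2\pi}\,\frac{(q,ab,ac,ad,bc,bd,cd;q)_\infty}{(abcd;q)_\infty}\int_0^\pi\frac{(\cos\theta)^n\,(e^{2i\theta},e^{-2i\theta};q)_\infty\,d\theta}{(ae^{i\theta},ae^{-i\theta},be^{i\theta},be^{-i\theta},ce^{i\theta},ce^{-i\theta},de^{i\theta},de^{-i\theta};q)_\infty},$$ which is normalized so that $\mathscr{L}_q(1)=1$ (the Askey-Wilson integral). *)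

(* Defs.v *)
(* Stdlib reals with Coquelicot: [C] is Coquelicot's type of complex numbers. *)
From Stdlib Require Import Reals List Lia.
From Coquelicot Require Import Coquelicot.

Open Scope R_scope.
Open Scope C_scope.

Fixpoint qpoch (x : C) (q : R) (n : nat) : C :=
  match n with
  | O => 1
  | S m => qpoch x q m * (1 - x * q ^ m)
  end.

(* The limit of the partial products.  [iota] returns the unique [l] satisfying
   its predicate; the product converges for every [x] as soon as [|q| < 1]. *)
Definition qpoch_inf (x : C) (q : R) : C :=
  @iota C_R_CompleteNormedModule
    (fun l : C => filterlim (qpoch x q) eventually (locally l)).

(* The multi-parameter symbols (x_1, ..., x_r; q)_n and (x_1, ..., x_r; q)_oo. *)
Definition qpochs (xs : list C) (q : R) (n : nat) : C :=
  fold_right Cmult 1 (map (fun x => qpoch x q n) xs).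

Definition qpochs_inf (xs : list C) (q : R) : C :=
  fold_right Cmult 1 (map (fun x => qpoch_inf x q) xs).

Definition cis (theta : R) : C := (cos theta, sin theta).

Definition aw_weight (q : R) (a b c d : C) (theta : R) : C :=
  let z := cis theta in
  let z' := cis (- theta) in
  qpochs_inf (cis (2 * theta) :: cis (- (2 * theta)) :: nil) q /
  qpochs_inf (a * z :: a * z' :: b * z :: b * z' ::
              c * z :: c * z' :: d * z :: d * z' :: nil) q.

Definition aw_const (q : R) (a b c d : C) : C :=
  / (2 * PI) *
  (qpochs_inf (RtoC q :: a * b :: a * c :: a * d ::
               b * c :: b * d :: c * d :: nil) q /
   qpoch_inf (a * b * c * d) q).

(* Polynomials over [C] are identified with the polynomial functions they
   induce: the functional of C[x] is the restriction of [aw_functional] to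
   polynomial functions, and its value at x^n is
   [aw_functional q a b c d (fun x => x ^ n)]. *)
Definition aw_functional (q : R) (a b c d : C) (p : C -> C) : C :=
  aw_const q a b c d *
  @RInt C_R_CompleteNormedModule
    (fun theta : R => p (RtoC (cos theta)) * aw_weight q a b c d theta) 0 PI.

(* Formal power series in [u] over [C]: [f n] is the coefficient of u^n. *)
Definition fps : Type := nat -> C.

Definition fps_one : fps := fun n => match n with O => 1 | S _ => 0 end.

Definition fps_X : fps := fun n => match n with 1%nat => 1 | _ => 0 end.

Definition fps_sub (f g : fps) : fps := fun n => f n - g n.

Definition fps_scal (k : C) (f : fps) : fps := fun n => k * f n.

Definition fps_mul (f g : fps) : fps :=
  fun n => sum_n (fun k => f k * g (n - k)%nat) n.

Fixpoint fps_pow (f : fps) (n : nat) : fps :=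
  match n with
  | O => fps_one
  | S m => fps_mul (fps_pow f m) f
  end.

Fixpoint fps_prod (F : nat -> fps) (n : nat) : fps :=
  match n with
  | O => fps_one
  | S m => fps_mul (fps_prod F m) (F m)
  end.

(* Coefficients n, n - 1, ..., 0 (in this order) of the inverse of [f], from
   g_0 = 1 / f_0 and g_(m+1) = - (1 / f_0) * sum_(k <= m) f_(k+1) g_(m-k). *)
Fixpoint fps_inv_coefs (f : fps) (n : nat) : list C :=
  match n with
  | O => / f 0%nat :: nil
  | S m =>
      let l := fps_inv_coefs f m in
      (- / f 0%nat * sum_n (fun k => f (S k) * nth k l (RtoC 0)) m) :: l
  end.

Definition fps_inv (f : fps) : fps := fun n => hd (RtoC 0) (fps_inv_coefs f n).

Definition fps_div (f g : fps) : fps := fps_mul f (fps_inv g).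

(* The series sum_n F_n converges to [s] in the u-adic topology: every
   coefficient of the partial sums is eventually equal to that of [s]. *)
Definition is_fps_sum (F : nat -> fps) (s : fps) : Prop :=
  forall m : nat, exists N : nat, forall n : nat, (N <= n)%nat ->
    sum_n (fun k => F k m) n = s m.

Lemma nth_fps_inv_coefs (f : fps) (n k : nat) :
  (k <= n)%nat -> nth k (fps_inv_coefs f n) (RtoC 0) = fps_inv f (n - k)%nat.
Proof.
revert k; induction n as [|n IH]; intros [|k] Hk; try reflexivity.
- lia.
- exact (IH k (le_S_n _ _ Hk)).
Qed.

Lemma fps_mul_inv (f : fps) :
  f 0%nat <> 0 -> forall n, fps_mul f (fps_inv f) n = fps_one n.
Proof.
intros Hf [|n]; unfold fps_mul.
- rewrite sum_O; unfold fps_inv; simpl.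
  field; exact Hf.
- unfold sum_n; rewrite sum_n_m_Chasles with (m := 0%nat) by lia.
  rewrite sum_n_n.
  rewrite <- sum_n_m_S.
  rewrite (sum_n_m_ext_loc _
    (fun k => f (S k) * nth k (fps_inv_coefs f n) (RtoC 0))).
  2: { intros k [_ Hk]; rewrite nth_fps_inv_coefs by exact Hk; reflexivity. }
  change (f 0%nat *
    (- / f 0%nat * sum_n (fun k => f (S k) * nth k (fps_inv_coefs f n) (RtoC 0)) n) +
    sum_n (fun k => f (S k) * nth k (fps_inv_coefs f n) (RtoC 0)) n = 0).
  field; exact Hf.
Qed.

Lemma fps_pow_X (n m : nat) :
  fps_pow fps_X n m = if Nat.eqb m n then RtoC 1 else RtoC 0.
Proof.
revert m; induction n as [|n IH]; intros m; [now destruct m|].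
change (sum_n (fun k => fps_pow fps_X n k * fps_X (m - k)%nat) m
        = if Nat.eqb m (S n) then RtoC 1 else RtoC 0).
destruct m as [|m].
- rewrite sum_O; simpl; ring.
- rewrite sum_Sn.
  rewrite Nat.sub_diag.
  change (sum_n (fun k => fps_pow fps_X n k * fps_X (S m - k)%nat) m
          + fps_pow fps_X n (S m) * 0 = if Nat.eqb (S m) (S n) then RtoC 1 else RtoC 0).
  assert (H : sum_n (fun k => fps_pow fps_X n k * fps_X (S m - k)%nat) m
              = fps_pow fps_X n m).
  { destruct m as [|m].
    - rewrite sum_O; simpl; ring.
    - rewrite sum_Sn.
      replace (S (S m) - S m)%nat with 1%nat by lia.
      rewrite (sum_n_ext_loc _ (fun _ => zero)).
      2: { intros k Hk.
           replace (S (S m) - k)%nat with (S (S (m - k))) by lia.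
           change (fps_pow fps_X n k * 0 = 0); ring. }
      unfold sum_n; rewrite sum_n_m_const_zero, plus_zero_l.
      change (fps_pow fps_X n (S m) * 1 = fps_pow fps_X n (S m)); ring. }
  rewrite H, IH; simpl; ring.
Qed.

(* A coefficient sequence is the formal power series sum_n s_n u^n. *)
Lemma is_fps_sum_coef (s : nat -> C) :
  is_fps_sum (fun n => fps_scal (s n) (fps_pow fps_X n)) s.
Proof.
intros m; exists m; intros n Hn; induction Hn as [|n Hn IH].
- clear; destruct m as [|m].
  + rewrite sum_O; unfold fps_scal; rewrite fps_pow_X; simpl; ring.
  + rewrite sum_Sn.
    rewrite (sum_n_ext_loc _ (fun _ => zero)).
    2: { intros k Hk; unfold fps_scal; rewrite fps_pow_X.
         rewrite (proj2 (Nat.eqb_neq (S m) k)) by lia.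
         change (s k * 0 = 0); ring. }
    unfold sum_n; rewrite sum_n_m_const_zero, plus_zero_l.
    unfold fps_scal; rewrite fps_pow_X, Nat.eqb_refl; exact (Cmult_1_r _).
- rewrite sum_Sn; cbv beta in IH; rewrite IH; unfold fps_scal.
  rewrite fps_pow_X.
  rewrite (proj2 (Nat.eqb_neq m (S n))) by lia.
  change (s m + s (S n) * 0 = s m); ring.
Qed.

Definition aw_node (q : R) (a : C) (j : nat) : C :=
  (/ q ^ j / a + a * q ^ j) / 2.

(* Main.v *)
Require Import Defs.
From Stdlib Require Import Reals List Lra Lia Wf_nat.
From Coquelicot Require Import Coquelicot.

Open Scope R_scope.
Open Scope C_scope.

(** Write W(z; a, b, c, d) for the Askey-Wilson weight at z = e^{i theta} and I(a, b, c, d)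
    for its integral over 0 <= theta <= pi.

    With phi_n(x) = (a z, a / z; q)_n, x = (z + 1/z)/2, each factor of phi_n is
    1 - 2 a q^k x + a^2 q^{2k} = 2 a q^k (a_k - x), so phi_n is a multiple of the Newton
    polynomial (x - a_0) ... (x - a_{n-1}).  Newton interpolation at the nodes a_j is the
    identity
      1 / (1 - x u) = sum_n (x - a_0) ... (x - a_{n-1}) u^n / ((1 - a_0 u) ... (1 - a_n u)),
    whose coefficient of u^m is [newton_expansion].  Applying the functional coefficientwise
    leaves its values on phi_n to be computed.  Since phi_n W(z; a, b, c, d) =
    W(z; a q^n, b, c, d), that value is the ratio of I(a q^n, b, c, d) to I(a, b, c, d), times
    the normalization: everything rests on the evaluation of the Askey-Wilson integral
    ([askey_wilson_integral]) and on the recurrence ([aw_integral_shift])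
      (1 - abcd) I(aq, b, c, d) = (1 - ab)(1 - ac)(1 - ad) I(a, b, c, d).

    The recurrence is equivalent to the value of the first moment ([aw_first_moment]).  It
    comes from a kernel F, analytic on q <= |z| <= 1, with F(q z) = - F(1/z) on the unit
    circle ([aw_kernel_dilated]).  The circle integral of F is invariant under z -> q z by
    analyticity and under z -> 1/z by symmetry, so it equals its opposite and vanishes, and
    F(z) + F(1/z) is W times an affine function of cos theta.  Invariance under dilation is
    obtained without complex integration: F is a uniform limit of Laurent polynomials on the
    annulus ([approximable]), and for Laurent polynomials both integrals are read off the
    constant term ([symmetric_integral_dilation]).

    Iterating the recurrence and letting a q^n tend to 0 replaces a by 0; doing the same with
    b, c, d gives I(a, b, c, d) as an explicit product times I(0, 0, 0, 0)
    ([aw_integral_product]).  That constant is found from one case where the integral is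
    elementary: at (q, -q, sqrt q, - sqrt q) the weight collapses to 4 sin^2 theta, the
    weight of the Chebyshev polynomials of the second kind ([aw_integral_zero]). *)

Notation C_RModule := C_R_CompleteNormedModule.

(* Values of sums and integrals are typed by carriers of algebraic structures, which [ring]
   and [field] do not identify with [C]. *)
Ltac C_eq := match goal with |- @eq _ ?x ?y => change (@eq C x y) end.
Ltac Cring := C_eq; ring.

(** * Limits of complex sequences *)

(** Convergence measured by the modulus, so that the calculus of real limits applies; it
    agrees with convergence in the product topology ([Clim_filterlim], [filterlim_Clim]). *)
Definition Clim (f : nat -> C) (l : C) : Prop :=
  is_lim_seq (fun n => Cmod (f n - l)) 0%R.

Lemma ball_of_Cmod (x y : C) (eps : R) :
  (Cmod (y - x) < eps)%R -> @ball C_RModule x eps y.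
Proof. exact (C_NormedModule_mixin_compat1 x y eps). Qed.

Lemma Clim_filterlim (f : nat -> C) (l : C) :
  Clim f l ->
  filterlim f eventually (@locally C_RModule l).
Proof.
intros H; apply filterlim_locally; intros eps.
apply is_lim_seq_spec in H; destruct (H eps) as [N HN].
exists N; intros n Hn; apply ball_of_Cmod.
specialize (HN n Hn); rewrite Rminus_0_r in HN.
rewrite Rabs_pos_eq in HN by apply Cmod_ge_0; exact HN.
Qed.

Lemma filterlim_Clim (f : nat -> C) (l : C) :
  filterlim f eventually (@locally C_RModule l) -> Clim f l.
Proof.
intros H.
assert (H' := proj1 (@filterlim_locally_ball_norm R_AbsRing nat C_R_NormedModule
  eventually _ f l) H).
apply is_lim_seq_spec; intros eps; destruct (H' eps) as [N HN].
exists N; intros n Hn; rewrite Rminus_0_r, Rabs_pos_eq by apply Cmod_ge_0.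
rewrite Cmod_norm; exact (HN n Hn).
Qed.

Lemma Clim_ext (f g : nat -> C) (l : C) :
  (forall n, f n = g n) -> Clim f l -> Clim g l.
Proof.
intros E; apply is_lim_seq_ext; intros n; now rewrite E.
Qed.

Lemma Clim_const (l : C) : Clim (fun _ => l) l.
Proof.
unfold Clim; apply is_lim_seq_ext with (fun _ => 0%R); [|apply is_lim_seq_const].
intros _; replace (l - l) with (RtoC 0) by ring; now rewrite Cmod_0.
Qed.

Lemma Clim_squeeze (f : nat -> C) (l : C) (e : nat -> R) :
  (forall n, (Cmod (f n - l) <= e n)%R) -> is_lim_seq e 0%R -> Clim f l.
Proof.
intros H He; unfold Clim.
apply is_lim_seq_le_le with (fun _ => 0%R) e; [|apply is_lim_seq_const|exact He].
intros n; split; [apply Cmod_ge_0|apply H].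
Qed.

Lemma Clim_mult (f g : nat -> C) (l m : C) :
  Clim f l -> Clim g m -> Clim (fun n => f n * g n) (l * m).
Proof.
intros Hf Hg.
apply Clim_squeeze with (fun n =>
  Cmod (f n - l) * Cmod (g n - m) + Cmod l * Cmod (g n - m) +
  Cmod m * Cmod (f n - l))%R.
- intros n.
  replace (f n * g n - l * m) with
    ((f n - l) * (g n - m) + l * (g n - m) + m * (f n - l)) by ring.
  rewrite <- !Cmod_mult.
  eapply Rle_trans; [apply Cmod_triangle|].
  apply Rplus_le_compat_r, Cmod_triangle.
- replace (Finite 0) with (Finite (0 * 0 + Cmod l * 0 + Cmod m * 0)%R)
    by (f_equal; ring).
  repeat apply is_lim_seq_plus'; apply is_lim_seq_mult'; trivial;
    apply is_lim_seq_const.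
Qed.

Lemma Clim_unique (f : nat -> C) (l m : C) : Clim f l -> Clim f m -> l = m.
Proof.
intros Hl Hm.
assert (H : (Cmod (l - m) <= 0)%R).
{ apply (is_lim_seq_le (fun _ => Cmod (l - m))
    (fun n => Cmod (f n - l) + Cmod (f n - m))%R (Cmod (l - m)) 0%R).
  - intros n; replace (l - m) with ((f n - m) + - (f n - l)) by ring.
    eapply Rle_trans; [apply Cmod_triangle|]; rewrite Cmod_opp; lra.
  - apply is_lim_seq_const.
  - replace (Finite 0) with (Finite (0 + 0)%R) by (f_equal; ring).
    now apply is_lim_seq_plus'. }
assert (E : l - m = 0).
{ apply Cmod_eq_0, Rle_antisym; [exact H|apply Cmod_ge_0]. }
replace l with ((l - m) + m) by ring; rewrite E; ring.
Qed.

Lemma Clim_double (f : nat -> C) (l : C) :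
  Clim f l -> Clim (fun n => f (2 * n)%nat) l.
Proof.
intros H; apply (is_lim_seq_subseq (fun n => Cmod (f n - l)) _ (fun n => 2 * n)%nat).
- apply eventually_subseq; intros n; lia.
- exact H.
Qed.

Lemma Clim_Cmod_le (f : nat -> C) (l x : C) (M : R) (N : nat) :
  (forall n, (N <= n)%nat -> (Cmod (f n - x) <= M)%R) -> Clim f l ->
  (Cmod (l - x) <= M)%R.
Proof.
intros H Hl.
apply (is_lim_seq_le_loc (fun _ => Cmod (l - x))
    (fun n => Cmod (f n - l) + M)%R (Cmod (l - x)) M).
- exists N; intros n Hn; replace (l - x) with ((f n - x) + - (f n - l)) by ring.
  eapply Rle_trans; [apply Cmod_triangle|]; rewrite Cmod_opp.
  specialize (H n Hn); lra.
- apply is_lim_seq_const.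
- replace (Finite M) with (Finite (0 + M)%R) by (f_equal; ring).
  apply is_lim_seq_plus'; [exact Hl|apply is_lim_seq_const].
Qed.

(** * Infinite products with geometrically small factors *)

(** If P_n is a product of factors u_k with |u_k - 1| <= K q^k, then |P_n| <= exp (K / (1 - q))
    and the tail of sum K q^k from n on is K / (1 - q) q^n; their product bounds the distance
    from P_n to its limit. *)
Definition geom_bound (q K : R) : R := (exp (K / (1 - q)) * (K / (1 - q)))%R.

Lemma Cmod_RtoC_pow (q : R) (n : nat) : (0 < q)%R -> Cmod (q ^ n) = (q ^ n)%R.
Proof.
intros Hq; rewrite Cmod_pow, Cmod_R, Rabs_pos_eq by lra; reflexivity.
Qed.

(** 1 + K q^k <= exp (K q^k), and the exponents form a geometric series. *)
Lemma prod_bounded (q K : R) (P u : nat -> C) :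
  (0 < q < 1)%R -> (0 <= K)%R -> P 0%nat = 1 ->
  (forall n, P (S n) = P n * u n) ->
  (forall n, (Cmod (u n - 1) <= K * q ^ n)%R) ->
  forall n, (Cmod (P n) <= exp (K / (1 - q)))%R.
Proof.
intros Hq HK P0 PS Hu.
assert (HQ : (0 < / (1 - q))%R) by (apply Rinv_0_lt_compat; lra).
assert (H : forall n, (Cmod (P n) <= exp (K * ((1 - q ^ n) / (1 - q))))%R).
{ induction n as [|n IH].
  - rewrite P0, Cmod_1; simpl.
    replace (K * ((1 - 1) / (1 - q)))%R with 0%R by (unfold Rdiv; ring).
    rewrite exp_0; lra.
  - rewrite PS, Cmod_mult.
    replace (K * ((1 - q ^ S n) / (1 - q)))%R
      with (K * ((1 - q ^ n) / (1 - q)) + K * q ^ n)%R by (simpl; field; lra).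
    rewrite exp_plus.
    apply Rmult_le_compat; try apply Cmod_ge_0; [exact IH|].
    replace (u n) with (1 + (u n - 1)) by ring.
    eapply Rle_trans; [apply Cmod_triangle|]; rewrite Cmod_1.
    eapply Rle_trans; [|apply exp_ineq1_le].
    specialize (Hu n); lra. }
intros n; eapply Rle_trans; [apply H|].
destruct (Rle_lt_or_eq_dec (K * ((1 - q ^ n) / (1 - q))) (K / (1 - q))) as [L|E].
- unfold Rdiv; apply Rmult_le_compat_l; [exact HK|].
  assert (0 < q ^ n)%R by (apply pow_lt; lra).
  rewrite <- (Rmult_1_l (/ (1 - q))) at 2; apply Rmult_le_compat_r; lra.
- left; apply exp_increasing; exact L.
- rewrite E; lra.
Qed.

Lemma prod_cauchy (q K : R) (P u : nat -> C) :
  (0 < q < 1)%R -> (0 <= K)%R -> P 0%nat = 1 ->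
  (forall n, P (S n) = P n * u n) ->
  (forall n, (Cmod (u n - 1) <= K * q ^ n)%R) ->
  forall n m, (n <= m)%nat ->
  (Cmod (P m - P n) <= geom_bound q K * q ^ n)%R.
Proof.
intros Hq HK P0 PS Hu n m Hnm.
assert (HQ : (0 < / (1 - q))%R) by (apply Rinv_0_lt_compat; lra).
set (B := exp (K / (1 - q))).
assert (HB : (0 < B)%R) by apply exp_pos.
assert (Hpos : forall k, (0 < q ^ k)%R) by (intros; apply pow_lt; lra).
assert (H : (Cmod (P m - P n) <= B * K * ((q ^ n - q ^ m) / (1 - q)))%R).
{ induction Hnm as [|m Hnm IH].
  - replace (P n - P n) with (RtoC 0) by ring; rewrite Cmod_0.
    unfold Rdiv; rewrite Rminus_diag; right; ring.
  - replace (P (S m) - P n) with ((P m - P n) + P m * (u m - 1))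
      by (rewrite PS; ring).
    eapply Rle_trans; [apply Cmod_triangle|]; rewrite Cmod_mult.
    replace (B * K * ((q ^ n - q ^ S m) / (1 - q)))%R
      with (B * K * ((q ^ n - q ^ m) / (1 - q)) + B * (K * q ^ m))%R
      by (simpl; field; lra).
    apply Rplus_le_compat; [exact IH|].
    apply Rmult_le_compat; try apply Cmod_ge_0; [|apply Hu].
    now apply (prod_bounded q K P u). }
eapply Rle_trans; [exact H|]; unfold geom_bound; fold B.
replace (B * (K / (1 - q)) * q ^ n)%R with (B * K * (q ^ n / (1 - q)))%R
  by (field; lra).
apply Rmult_le_compat_l; [apply Rmult_le_pos; lra|].
unfold Rdiv; apply Rmult_le_compat_r; [lra|]; specialize (Hpos m); lra.
Qed.

Lemma geom_bound_ge_0 (q K : R) :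
  (0 < q < 1)%R -> (0 <= K)%R -> (0 <= geom_bound q K)%R.
Proof.
intros Hq HK; unfold geom_bound.
assert (0 < / (1 - q))%R by (apply Rinv_0_lt_compat; lra).
apply Rmult_le_pos; [left; apply exp_pos|apply Rmult_le_pos; lra].
Qed.

Lemma is_lim_geom (q M : R) :
  (0 < q < 1)%R -> is_lim_seq (fun n => M * q ^ n)%R 0%R.
Proof.
intros Hq; replace (Finite 0) with (Finite (M * 0)%R) by (f_equal; ring).
apply is_lim_seq_mult'; [apply is_lim_seq_const|].
apply is_lim_seq_geom; rewrite Rabs_pos_eq; lra.
Qed.

(** Stated for an arbitrary product because it serves twice: for (x; q)_n and for its inverse.
    The rate depends on K alone, which makes the convergence uniform in x. *)
Lemma prod_limit (q K : R) (P u : nat -> C) :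
  (0 < q < 1)%R -> (0 <= K)%R -> P 0%nat = 1 ->
  (forall n, P (S n) = P n * u n) ->
  (forall n, (Cmod (u n - 1) <= K * q ^ n)%R) ->
  exists l, Clim P l /\
    forall n, (Cmod (P n - l) <= geom_bound q K * q ^ n)%R.
Proof.
intros Hq HK P0 PS Hu.
assert (T := prod_cauchy q K P u Hq HK P0 PS Hu).
assert (HM := geom_bound_ge_0 q K Hq HK).
assert (C0 : exists l, filterlim P eventually (@locally C_RModule l)).
{ apply (proj1 (@filterlim_locally_cauchy nat C_RModule
    eventually _ P)).
  intros eps.
  assert (L := is_lim_geom q (2 * geom_bound q K) Hq).
  apply is_lim_seq_spec in L; destruct (L eps) as [N HN].
  exists (fun n => (N <= n)%nat); split; [now exists N|].
  intros m n Hm Hn; apply ball_of_Cmod.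
  specialize (HN N (Nat.le_refl N)); rewrite Rminus_0_r in HN.
  apply Rle_lt_trans with (2 := Rle_lt_trans _ _ _ (Rle_abs _) HN).
  replace (P n - P m) with ((P n - P N) + - (P m - P N)) by ring.
  eapply Rle_trans; [apply Cmod_triangle|]; rewrite Cmod_opp.
  assert (A := T N n Hn); assert (B := T N m Hm); lra. }
destruct C0 as [l Hl]; apply filterlim_Clim in Hl.
exists l; split; [exact Hl|]; intros n.
replace (P n - l) with (- (l - P n)) by ring; rewrite Cmod_opp.
apply Clim_Cmod_le with P n; [intros m Hm; now apply T|exact Hl].
Qed.

Lemma Cmod_qpoch_factor (q r : R) (x : C) (n : nat) :
  (0 < q)%R -> (Cmod x <= r)%R -> (Cmod (1 - x * q ^ n - 1) <= r * q ^ n)%R.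
Proof.
intros Hq Hx; replace (1 - x * q ^ n - 1) with (- (x * q ^ n)) by ring.
rewrite Cmod_opp, Cmod_mult, Cmod_RtoC_pow by exact Hq.
apply Rmult_le_compat_r; [apply pow_le; lra|exact Hx].
Qed.

Lemma qpoch_inf_unique (x l : C) (q : R) :
  Clim (qpoch x q) l -> qpoch_inf x q = l.
Proof.
intros H; apply (@iota_filterlim_locally R_AbsRing C_RModule nat
  eventually _ (qpoch x q) l), Clim_filterlim, H.
Qed.

Lemma qpoch_lim (q : R) (x : C) :
  (0 < q < 1)%R -> Clim (qpoch x q) (qpoch_inf x q).
Proof.
intros Hq.
destruct (prod_limit q (Cmod x) (qpoch x q) (fun n => 1 - x * q ^ n))
  as [l [Hl _]]; trivial.
- apply Cmod_ge_0.
- intros n; apply Cmod_qpoch_factor; lra.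
- now rewrite (qpoch_inf_unique x l q Hl).
Qed.

Lemma qpoch_rate (q r : R) (x : C) (n : nat) :
  (0 < q < 1)%R -> (Cmod x <= r)%R ->
  (Cmod (qpoch x q n - qpoch_inf x q) <= geom_bound q r * q ^ n)%R.
Proof.
intros Hq Hx.
destruct (prod_limit q r (qpoch x q) (fun n => 1 - x * q ^ n))
  as [l [Hl Hn]]; trivial.
- eapply Rle_trans; [apply Cmod_ge_0|exact Hx].
- intros k; apply Cmod_qpoch_factor; lra.
- rewrite (qpoch_inf_unique x l q Hl); apply Hn.
Qed.

Lemma one_minus_neq_0 (x : C) : (Cmod x < 1)%R -> 1 - x <> 0.
Proof.
intros Hx E; apply (Rlt_irrefl 1); rewrite <- Cmod_1 at 1.
replace (RtoC 1) with (1 - x + x) by ring; rewrite E, Cplus_0_l; exact Hx.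
Qed.

Lemma Cmod_one_minus (x : C) : (1 - Cmod x <= Cmod (1 - x))%R.
Proof.
assert (H := Cmod_triangle (1 - x) x).
replace (1 - x + x) with (RtoC 1) in H by ring; rewrite Cmod_1 in H; lra.
Qed.

Lemma Cmod_mult_qpow (q : R) (x : C) (n : nat) :
  (0 < q < 1)%R -> (Cmod (x * q ^ n) <= Cmod x)%R.
Proof.
intros Hq; rewrite Cmod_mult, Cmod_RtoC_pow by lra.
rewrite <- (Rmult_1_r (Cmod x)) at 2; apply Rmult_le_compat_l; [apply Cmod_ge_0|].
rewrite <- (pow1 n); apply pow_incr; lra.
Qed.

Lemma qpoch_neq_0 (q : R) (x : C) (n : nat) :
  (0 < q < 1)%R -> (Cmod x < 1)%R -> qpoch x q n <> 0.
Proof.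
intros Hq Hx; induction n as [|n IH]; simpl.
- exact C1_nz.
- apply Cmult_neq_0; [exact IH|apply one_minus_neq_0].
  eapply Rle_lt_trans; [apply Cmod_mult_qpow; lra|exact Hx].
Qed.

Lemma Cmod_inv_qpoch_factor (q r : R) (x : C) (n : nat) :
  (0 < q < 1)%R -> (Cmod x <= r)%R -> (r < 1)%R ->
  (Cmod (/ (1 - x * q ^ n) - 1) <= r / (1 - r) * q ^ n)%R.
Proof.
intros Hq Hx Hr.
assert (Hy : (Cmod (x * q ^ n) <= r)%R)
  by (eapply Rle_trans; [apply Cmod_mult_qpow; lra|exact Hx]).
assert (Hn : 1 - x * q ^ n <> 0) by (apply one_minus_neq_0; lra).
replace (/ (1 - x * q ^ n) - 1) with (x * q ^ n * / (1 - x * q ^ n))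
  by (field; exact Hn).
rewrite Cmod_mult, Cmod_inv by exact Hn.
replace (r / (1 - r) * q ^ n)%R with (r * q ^ n * / (1 - r))%R by (field; lra).
assert (H1 := Cmod_one_minus (x * q ^ n)).
apply Rmult_le_compat; [apply Cmod_ge_0| | |].
- left; apply Rinv_0_lt_compat; lra.
- rewrite Cmod_mult, Cmod_RtoC_pow by lra.
  apply Rmult_le_compat_r; [apply pow_le; lra|exact Hx].
- apply Rinv_le_contravar; lra.
Qed.

(** The inverses 1 / (x; q)_n are themselves products with factors close to 1, so they converge;
    this shows both that the infinite product does not vanish and that the convergence of the
    inverses is uniform for |x| <= r < 1. *)
Lemma inv_qpoch_limit (q r : R) (x : C) :
  (0 < q < 1)%R -> (Cmod x <= r)%R -> (r < 1)%R ->
  qpoch_inf x q <> 0 /\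
  forall n, (Cmod (/ qpoch x q n - / qpoch_inf x q)
             <= geom_bound q (r / (1 - r)) * q ^ n)%R.
Proof.
intros Hq Hx Hr.
assert (Hr0 : (0 <= r)%R) by (eapply Rle_trans; [apply Cmod_ge_0|exact Hx]).
assert (Hnz : forall n, qpoch x q n <> 0) by (intros n; apply qpoch_neq_0; lra).
destruct (prod_limit q (r / (1 - r)) (fun n => / qpoch x q n)
  (fun n => / (1 - x * q ^ n))) as [l [Hl Hn]]; trivial.
- apply Rmult_le_pos; [exact Hr0|left; apply Rinv_0_lt_compat; lra].
- simpl; field; apply C1_nz.
- intros n; simpl; field; split; [|apply Hnz].
  intros E; apply (Hnz (S n)); simpl; rewrite E; ring.
- intros n; apply Cmod_inv_qpoch_factor; lra.
- assert (E : qpoch_inf x q * l = 1).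
  { apply Clim_unique with (fun n => qpoch x q n * / qpoch x q n).
    - apply Clim_mult; [apply qpoch_lim; lra|exact Hl].
    - apply Clim_ext with (fun _ => RtoC 1); [|apply Clim_const].
      intros n; field; apply Hnz. }
  assert (Z : qpoch_inf x q <> 0)
    by (intros Z; rewrite Z, Cmult_0_l in E; now apply C1_nz).
  split; [exact Z|]; intros n.
  replace (/ qpoch_inf x q) with l; [apply Hn|].
  replace l with (/ qpoch_inf x q * (qpoch_inf x q * l)) by (field; exact Z).
  rewrite E; ring.
Qed.

Lemma qpoch_inf_neq_0 (q : R) (x : C) :
  (0 < q < 1)%R -> (Cmod x < 1)%R -> qpoch_inf x q <> 0.
Proof. intros Hq Hx; apply (inv_qpoch_limit q (Cmod x) x); lra. Qed.

Lemma qpoch_shift (q : R) (x : C) (n : nat) :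
  qpoch x q (S n) = (1 - x) * qpoch (x * q) q n.
Proof.
induction n as [|n IH]; [simpl; ring|].
change (qpoch x q (S n) * (1 - x * q ^ S n) =
  (1 - x) * (qpoch (x * q) q n * (1 - x * q * q ^ n))).
rewrite IH, Cpow_S; ring.
Qed.

Lemma qpoch_inf_shift (q : R) (x : C) :
  (0 < q < 1)%R -> qpoch_inf x q = (1 - x) * qpoch_inf (x * q) q.
Proof.
intros Hq; apply qpoch_inf_unique.
assert (H : Clim (fun n => qpoch x q (S n)) ((1 - x) * qpoch_inf (x * q) q)).
{ apply Clim_ext with (fun n => (1 - x) * qpoch (x * q) q n).
  - intros n; now rewrite qpoch_shift.
  - apply Clim_mult; [apply Clim_const|apply qpoch_lim, Hq]. }
exact (proj2 (is_lim_seq_incr_1 (fun n => Cmod (qpoch x q n - _)) _) H).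
Qed.

Lemma qpoch_inf_0 (q : R) : qpoch_inf 0 q = 1.
Proof.
apply qpoch_inf_unique, Clim_ext with (fun _ => RtoC 1); [|apply Clim_const].
induction n as [|n IH]; simpl; [reflexivity|rewrite <- IH; ring].
Qed.

(** The factors of (x; s)_oo with even and with odd exponents. *)
Lemma qpoch_inf_dissect (s : R) (x : C) :
  (0 < s < 1)%R ->
  qpoch_inf x (s * s) * qpoch_inf (s * x) (s * s) = qpoch_inf x s.
Proof.
intros Hs.
assert (Hq : (0 < s * s < 1)%R) by (split; nra).
apply Clim_unique with (fun n => qpoch x (s * s) n * qpoch (s * x) (s * s) n).
- now apply Clim_mult; apply qpoch_lim.
- apply Clim_ext with (fun n => qpoch x s (2 * n)%nat).
  + induction n as [|n IH]; [simpl; ring|].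
    replace (2 * S n)%nat with (S (S (2 * n))) by lia.
    change (qpoch x s (2 * n) * (1 - x * s ^ (2 * n)) * (1 - x * s ^ S (2 * n)) =
      qpoch x (s * s)%R n * (1 - x * (s * s)%R ^ n) *
      (qpoch (s * x) (s * s)%R n * (1 - s * x * (s * s)%R ^ n))).
    rewrite IH, Cpow_S, Cpow_mult_r, RtoC_mult.
    replace (RtoC s ^ 2) with (RtoC s * RtoC s) by ring; ring.
  + apply Clim_double, qpoch_lim, Hs.
Qed.

Lemma qpoch_inf_square (s : R) (x : C) :
  (0 < s < 1)%R ->
  qpoch_inf x s * qpoch_inf (- x) s = qpoch_inf (x * x) (s * s).
Proof.
intros Hs.
assert (Hq : (0 < s * s < 1)%R) by (split; nra).
apply Clim_unique with (fun n => qpoch x s n * qpoch (- x) s n).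
- now apply Clim_mult; apply qpoch_lim.
- apply Clim_ext with (fun n => qpoch (x * x) (s * s) n).
  + induction n as [|n IH]; simpl; [ring|].
    rewrite IH, RtoC_mult, Cpow_mult_l; ring.
  + apply qpoch_lim, Hq.
Qed.

(** * Uniform limits of Laurent polynomials on an annulus *)

(** Monomials z^m (1/z)^n with two natural exponents make products and dilations direct, at the
    cost of identifying functions that agree off 0. *)
Inductive laurent : (C -> C) -> Prop :=
| laurent_monomial (c : C) (m n : nat) :
    laurent (fun z => c * z ^ m * (/ z) ^ n)
| laurent_plus (f g : C -> C) :
    laurent f -> laurent g -> laurent (fun z => f z + g z)
| laurent_ext (f g : C -> C) :
    (forall z : C, z <> 0 -> f z = g z) -> laurent f -> laurent g.

Lemma laurent_mult (f g : C -> C) :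
  laurent f -> laurent g -> laurent (fun z => f z * g z).
Proof.
intros Hf Hg; induction Hf as [c m n|f1 f2 _ IH1 _ IH2|f1 f2 E _ IH].
- induction Hg as [c' m' n'|g1 g2 _ IH1 _ IH2|g1 g2 E _ IH].
  + eapply laurent_ext; [|exact (laurent_monomial (c * c') (m + m') (n + n'))].
    intros z Hz; cbv beta; rewrite !Cpow_add_r; ring.
  + eapply laurent_ext; [|exact (laurent_plus _ _ IH1 IH2)].
    intros z Hz; cbv beta; ring.
  + eapply laurent_ext; [|exact IH].
    intros z Hz; cbv beta; now rewrite E.
- eapply laurent_ext; [|exact (laurent_plus _ _ IH1 IH2)].
  intros z Hz; cbv beta; ring.
- eapply laurent_ext; [|exact IH].
  intros z Hz; cbv beta; now rewrite E.
Qed.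

Definition annulus (r : R) (z : C) : Prop := (r <= Cmod z <= 1)%R.

(** A replacement for analyticity near the annulus: the class is closed under sums, products and
    uniform limits, and it still sees the constant Laurent coefficient. *)
Definition approximable (r : R) (f : C -> C) : Prop :=
  forall eps : R, (0 < eps)%R -> exists p, laurent p /\
    forall z, annulus r z -> (Cmod (f z - p z) <= eps)%R.

Lemma annulus_neq_0 (r : R) (z : C) : (0 < r)%R -> annulus r z -> z <> 0.
Proof. intros Hr [Hz _] E; rewrite E, Cmod_0 in Hz; lra. Qed.

Lemma laurent_approximable (r : R) (f : C -> C) :
  laurent f -> approximable r f.
Proof.
intros Hf eps Heps; exists f; split; [exact Hf|]; intros z _.
replace (f z - f z) with (RtoC 0) by ring; rewrite Cmod_0; lra.
Qed.

Lemma approximable_ulim (r : R) (f : C -> C) :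
  (forall eps : R, (0 < eps)%R -> exists g, approximable r g /\
     forall z, annulus r z -> (Cmod (f z - g z) <= eps)%R) ->
  approximable r f.
Proof.
intros H eps Heps.
destruct (H (eps / 2)%R) as [g [Hg Eg]]; [lra|].
destruct (Hg (eps / 2)%R) as [p [Hp Ep]]; [lra|].
exists p; split; [exact Hp|]; intros z Hz.
replace (f z - p z) with ((f z - g z) + (g z - p z)) by ring.
eapply Rle_trans; [apply Cmod_triangle|].
specialize (Eg z Hz); specialize (Ep z Hz); lra.
Qed.

Lemma approximable_ext (r : R) (f g : C -> C) :
  (forall z, annulus r z -> f z = g z) ->
  approximable r f -> approximable r g.
Proof.
intros E Hf eps Heps; destruct (Hf eps Heps) as [p [Hp Ep]].
exists p; split; [exact Hp|]; intros z Hz; rewrite <- E by exact Hz; now apply Ep.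
Qed.

Lemma approximable_const (r : R) (c : C) : approximable r (fun _ => c).
Proof.
apply laurent_approximable.
eapply laurent_ext; [|exact (laurent_monomial c 0 0)]; intros z _; simpl; ring.
Qed.

Lemma approximable_id (r : R) : approximable r (fun z => z).
Proof.
apply laurent_approximable.
eapply laurent_ext; [|exact (laurent_monomial 1 1 0)]; intros z _; simpl; ring.
Qed.

Lemma approximable_inv_id (r : R) : approximable r (fun z => / z).
Proof.
apply laurent_approximable.
eapply laurent_ext; [|exact (laurent_monomial 1 0 1)]; intros z _; simpl; ring.
Qed.

Lemma approximable_plus (r : R) (f g : C -> C) :
  approximable r f -> approximable r g -> approximable r (fun z => f z + g z).
Proof.
intros Hf Hg eps Heps.
destruct (Hf (eps / 2)%R) as [p [Hp Ep]]; [lra|].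
destruct (Hg (eps / 2)%R) as [p' [Hp' Ep']]; [lra|].
exists (fun z => p z + p' z); split; [now apply laurent_plus|]; intros z Hz.
replace (f z + g z - (p z + p' z)) with ((f z - p z) + (g z - p' z)) by ring.
eapply Rle_trans; [apply Cmod_triangle|].
specialize (Ep z Hz); specialize (Ep' z Hz); lra.
Qed.

Lemma laurent_bounded (r : R) (f : C -> C) :
  (0 < r)%R -> laurent f ->
  exists M, (0 <= M)%R /\ forall z, annulus r z -> (Cmod (f z) <= M)%R.
Proof.
intros Hr Hf; induction Hf as [c m n|f1 f2 _ IH1 _ IH2|f1 f2 E _ IH].
- assert (Hn : (0 <= (/ r) ^ n)%R)
    by (apply pow_le; left; apply Rinv_0_lt_compat, Hr).
  exists (Cmod c * (/ r) ^ n)%R; split.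
  + apply Rmult_le_pos; [apply Cmod_ge_0|exact Hn].
  + intros z Hz; rewrite !Cmod_mult, !Cmod_pow.
    rewrite Cmod_inv by now apply annulus_neq_0 with r.
    apply Rmult_le_compat.
    * apply Rmult_le_pos; [|apply pow_le]; apply Cmod_ge_0.
    * apply pow_le; left; apply Rinv_0_lt_compat; destruct Hz; lra.
    * rewrite <- (Rmult_1_r (Cmod c)) at 2.
      apply Rmult_le_compat_l; [apply Cmod_ge_0|].
      rewrite <- (pow1 m); apply pow_incr; split; [apply Cmod_ge_0|apply Hz].
    * apply pow_incr; split.
      -- left; apply Rinv_0_lt_compat; destruct Hz; lra.
      -- apply Rinv_le_contravar; [exact Hr|apply Hz].
- destruct IH1 as [M1 [H1 B1]], IH2 as [M2 [H2 B2]].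
  exists (M1 + M2)%R; split; [lra|]; intros z Hz.
  eapply Rle_trans; [apply Cmod_triangle|].
  specialize (B1 z Hz); specialize (B2 z Hz); lra.
- destruct IH as [M [HM B]]; exists M; split; [exact HM|]; intros z Hz.
  rewrite <- (E z) by (now apply annulus_neq_0 with r).
  now apply B.
Qed.

Lemma approximable_bounded (r : R) (f : C -> C) :
  (0 < r)%R -> approximable r f ->
  exists M, (0 <= M)%R /\ forall z, annulus r z -> (Cmod (f z) <= M)%R.
Proof.
intros Hr Hf; destruct (Hf 1%R) as [p [Hp Ep]]; [lra|].
destruct (laurent_bounded r p Hr Hp) as [M [HM B]].
exists (M + 1)%R; split; [lra|]; intros z Hz.
replace (f z) with (p z + (f z - p z)) by ring.
eapply Rle_trans; [apply Cmod_triangle|].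
specialize (B z Hz); specialize (Ep z Hz); lra.
Qed.

Lemma approximable_mult (r : R) (f g : C -> C) :
  (0 < r)%R -> approximable r f -> approximable r g ->
  approximable r (fun z => f z * g z).
Proof.
intros Hr Hf Hg eps Heps.
destruct (approximable_bounded r f Hr Hf) as [M [HM BM]].
destruct (Hg (eps / (2 * (M + 1)))%R) as [p' [Hp' Ep']].
{ apply Rdiv_lt_0_compat; lra. }
destruct (laurent_bounded r p' Hr Hp') as [M' [HM' BM']].
destruct (Hf (eps / (2 * (M' + 1)))%R) as [p [Hp Ep]].
{ apply Rdiv_lt_0_compat; lra. }
exists (fun z => p z * p' z); split; [now apply laurent_mult|]; intros z Hz.
replace (f z * g z - p z * p' z)
  with (f z * (g z - p' z) + p' z * (f z - p z)) by ring.
eapply Rle_trans; [apply Cmod_triangle|]; rewrite !Cmod_mult.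
specialize (BM z Hz); specialize (BM' z Hz); specialize (Ep z Hz).
specialize (Ep' z Hz).
assert (H : forall a b c d : R, (0 <= a)%R -> (a <= b)%R -> (0 <= c)%R ->
  (c <= eps / (2 * (b + 1)))%R -> (a * c <= eps / 2)%R).
{ intros a b c d Ha Hab Hc Hcb.
  replace (eps / 2)%R with ((b + 1) * (eps / (2 * (b + 1))))%R by (field; lra).
  apply Rmult_le_compat; lra. }
assert (H1 := H _ _ _ 0%R (Cmod_ge_0 (f z)) BM (Cmod_ge_0 _) Ep').
assert (H2 := H _ _ _ 0%R (Cmod_ge_0 (p' z)) BM' (Cmod_ge_0 _) Ep).
lra.
Qed.

Lemma geometric_error (w : C) (S : nat -> C) (rho : R) :
  (Cmod w <= rho)%R -> (rho < 1)%R -> S 0%nat = 0 ->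
  (forall n, S (Datatypes.S n) = 1 + w * S n) ->
  forall n, (Cmod (/ (1 - w) - S n) <= / (1 - rho) * rho ^ n)%R.
Proof.
intros Hw Hrho S0 SS.
assert (Hn : 1 - w <> 0) by (apply one_minus_neq_0; lra).
assert (H1 := Cmod_one_minus w).
induction n as [|n IH].
- rewrite S0; replace (/ (1 - w) - 0) with (/ (1 - w)) by ring.
  rewrite Cmod_inv by exact Hn; simpl; rewrite Rmult_1_r.
  apply Rinv_le_contravar; lra.
- rewrite SS; replace (/ (1 - w) - (1 + w * S n)) with (w * (/ (1 - w) - S n))
    by (field; exact Hn).
  rewrite Cmod_mult; simpl.
  replace (/ (1 - rho) * (rho * rho ^ n))%R
    with (rho * (/ (1 - rho) * rho ^ n))%R by ring.
  apply Rmult_le_compat; trivial; apply Cmod_ge_0.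
Qed.

Lemma approximable_inv_one_minus (r rho : R) (f : C -> C) :
  (0 < r)%R -> (0 < rho < 1)%R -> approximable r f ->
  (forall z, annulus r z -> (Cmod (f z) <= rho)%R) ->
  approximable r (fun z => / (1 - f z)).
Proof.
intros Hr Hrho Hf Hb; apply approximable_ulim; intros eps Heps.
assert (L := is_lim_geom rho (/ (1 - rho)) Hrho).
apply is_lim_seq_spec in L; destruct (L (mkposreal eps Heps)) as [N HN].
specialize (HN N (Nat.le_refl N)); rewrite Rminus_0_r in HN; simpl in HN.
set (S := fix S (n : nat) (z : C) {struct n} : C :=
  match n with O => 0 | Datatypes.S m => 1 + f z * S m z end).
exists (S N); split.
- clear -Hr Hf; induction N as [|N IH]; simpl; [apply approximable_const|].
  apply approximable_plus; [apply approximable_const|].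
  now apply approximable_mult.
- intros z Hz; apply Rlt_le, (fun H => Rle_lt_trans _ _ _ H HN).
  eapply Rle_trans; [|apply Rle_abs].
  apply geometric_error with (S := fun n => S n z); trivial; [now apply Hb|lra].
Qed.

Lemma approximable_qpoch (q r : R) (f : C -> C) (n : nat) :
  (0 < r)%R -> approximable r f -> approximable r (fun z => qpoch (f z) q n).
Proof.
intros Hr Hf; induction n as [|n IH]; simpl; [apply approximable_const|].
apply approximable_mult; [exact Hr|exact IH|].
apply approximable_ext with (fun z => 1 + f z * (- q ^ n)).
- intros z _; ring.
- apply approximable_plus; [apply approximable_const|].
  apply approximable_mult; [exact Hr|exact Hf|apply approximable_const].
Qed.

(** The error bound is uniform in z, which is what [approximable_ulim] asks for. *)
Lemma approximable_geom_lim (q r M : R) (f : C -> C) (F : nat -> C -> C) :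
  (0 < q < 1)%R -> (forall n, approximable r (F n)) ->
  (forall n z, annulus r z -> (Cmod (F n z - f z) <= M * q ^ n)%R) ->
  approximable r f.
Proof.
intros Hq HF H; apply approximable_ulim; intros eps Heps.
assert (L := is_lim_geom q M Hq).
apply is_lim_seq_spec in L; destruct (L (mkposreal eps Heps)) as [N HN].
specialize (HN N (Nat.le_refl N)); rewrite Rminus_0_r in HN; simpl in HN.
exists (F N); split; [apply HF|]; intros z Hz.
replace (f z - F N z) with (- (F N z - f z)) by ring; rewrite Cmod_opp.
apply Rlt_le, (fun H => Rle_lt_trans _ _ _ H HN).
eapply Rle_trans; [now apply H|apply Rle_abs].
Qed.

Lemma approximable_qpoch_inf (q r : R) (f : C -> C) :
  (0 < q < 1)%R -> (0 < r)%R -> approximable r f ->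
  approximable r (fun z => qpoch_inf (f z) q).
Proof.
intros Hq Hr Hf.
destruct (approximable_bounded r f Hr Hf) as [M [HM BM]].
apply approximable_geom_lim with q (geom_bound q M)
  (fun n z => qpoch (f z) q n); [exact Hq| |].
- intros n; now apply approximable_qpoch.
- intros n z Hz; apply qpoch_rate; [exact Hq|now apply BM].
Qed.

Lemma approximable_inv_qpoch_inf (q r rho : R) (f : C -> C) :
  (0 < q < 1)%R -> (0 < r)%R -> (0 < rho < 1)%R -> approximable r f ->
  (forall z, annulus r z -> (Cmod (f z) <= rho)%R) ->
  approximable r (fun z => / qpoch_inf (f z) q).
Proof.
intros Hq Hr Hrho Hf Hb.
apply approximable_geom_lim with q (geom_bound q (rho / (1 - rho)))
  (fun n z => / qpoch (f z) q n); [exact Hq| |].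
- induction n as [|n IH].
  + apply approximable_ext with (fun _ => 1);
      [intros; simpl; field; exact C1_nz|apply approximable_const].
  + apply approximable_ext with
      (fun z => / qpoch (f z) q n * / (1 - f z * q ^ n)).
    * intros z Hz; simpl; field.
      assert (Hz' : (Cmod (f z) < 1)%R)
        by (eapply Rle_lt_trans; [now apply Hb|lra]).
      split; [|now apply qpoch_neq_0].
      apply one_minus_neq_0, (fun H => Rle_lt_trans _ _ _ H Hz').
      now apply Cmod_mult_qpow.
    * apply approximable_mult; [exact Hr|exact IH|].
      apply approximable_inv_one_minus with rho; [exact Hr|exact Hrho| |].
      -- apply approximable_mult; [exact Hr|exact Hf|apply approximable_const].
      -- intros z Hz; eapply Rle_trans; [now apply Cmod_mult_qpow|now apply Hb].
- intros n z Hz; apply inv_qpoch_limit; [exact Hq|now apply Hb|lra].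
Qed.

(** * Integrals over circles *)

Lemma continuous_pair_C (f g : R -> R) (t : R) :
  continuous f t -> continuous g t ->
  @continuous R_UniformSpace C_RModule (fun x => (f x, g x)) t.
Proof.
intros Hf Hg; apply filterlim_locally; intros eps.
assert (Hf' := proj1 (filterlim_locally f (f t)) Hf eps).
assert (Hg' := proj1 (filterlim_locally g (g t)) Hg eps).
generalize (filter_and _ _ Hf' Hg'); apply filter_imp.
intros x [H1 H2]; split; assumption.
Qed.

Lemma continuous_C_iff (f : R -> C) (t : R) :
  @continuous R_UniformSpace C_RModule f t <->
  forall eps : posreal, locally t (fun x => (Cmod (f x - f t) < eps)%R).
Proof.
split.
- intros H eps.
  assert (H' := proj1 (@filterlim_locally_ball_norm R_AbsRing R C_R_NormedModule
    (locally t) _ f (f t)) H eps).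
  revert H'; apply filter_imp; intros x Hx.
  rewrite Cmod_norm; exact Hx.
- intros H; apply filterlim_locally; intros eps.
  generalize (H eps); apply filter_imp; intros x Hx; now apply ball_of_Cmod.
Qed.

Lemma cis_plus (s t : R) : cis (s + t) = cis s * cis t.
Proof.
unfold cis, Cmult; simpl; rewrite cos_plus, sin_plus; f_equal; ring.
Qed.

Lemma cis_0 : cis 0 = 1.
Proof. unfold cis; now rewrite cos_0, sin_0. Qed.

Lemma cis_opp_mult (t : R) : cis t * cis (- t) = 1.
Proof. rewrite <- cis_plus, Rplus_opp_r; apply cis_0. Qed.

Lemma cis_neq_0 (t : R) : cis t <> 0.
Proof.
intros E; apply C1_nz; rewrite <- (cis_opp_mult t), E; ring.
Qed.

Lemma cis_inv (t : R) : / cis t = cis (- t).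
Proof.
rewrite <- (Cmult_1_r (/ cis t)), <- (cis_opp_mult t); field; apply cis_neq_0.
Qed.

Lemma Cmod_cis (t : R) : Cmod (cis t) = 1%R.
Proof.
unfold Cmod, cis; simpl; transitivity (sqrt 1); [|apply sqrt_1].
f_equal; assert (H := sin2_cos2 t); unfold Rsqr in H; lra.
Qed.

Lemma cis_pow (t : R) (n : nat) : cis t ^ n = cis (INR n * t).
Proof.
induction n as [|n IH].
- simpl; rewrite Rmult_0_l; symmetry; apply cis_0.
- rewrite Cpow_S, IH, <- cis_plus, S_INR; f_equal; ring.
Qed.

(** The modulus enters only through a constant, so the dependence on the angle is that of one
    frequency. *)
Lemma monomial_cis (c : C) (m n : nat) (rho t : R) :
  (0 < rho)%R ->
  c * (rho * cis t) ^ m * (/ (rho * cis t)) ^ n =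
  c * rho ^ m * (/ rho) ^ n * cis ((INR m - INR n) * t).
Proof.
intros Hrho.
assert (Hr : RtoC rho <> 0) by (intros E; injection E; lra).
rewrite Cpow_mult_l, cis_pow.
replace (/ (rho * cis t)) with (/ rho * / cis t)
  by (field; split; [apply cis_neq_0|exact Hr]).
rewrite Cpow_mult_l, cis_inv, cis_pow.
replace ((INR m - INR n) * t)%R with (INR m * t + INR n * - t)%R by ring.
rewrite cis_plus; ring.
Qed.

Lemma laurent_continuous (p : C -> C) (rho t : R) :
  (0 < rho)%R -> laurent p ->
  @continuous R_UniformSpace C_RModule (fun x => p (rho * cis x)) t.
Proof.
intros Hrho Hp; revert t; induction Hp as [c m n|f g _ IH1 _ IH2|f g E _ IH];
  intros t.
- set (k := c * rho ^ m * (/ rho) ^ n); set (w := (INR m - INR n)%R).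
  apply (@continuous_ext R_UniformSpace C_RModule (fun x : R =>
    (fst k * cos (w * x) - snd k * sin (w * x),
     fst k * sin (w * x) + snd k * cos (w * x))%R)).
  { intros x; rewrite monomial_cis by exact Hrho; fold k w.
    unfold cis, Cmult; reflexivity. }
  apply continuous_pair_C; apply (ex_derive_continuous (V := R_NormedModule));
    auto_derive; trivial.
- apply (@continuous_plus R_UniformSpace R_AbsRing C_R_NormedModule);
    [apply IH1|apply IH2].
- apply (@continuous_ext R_UniformSpace C_RModule (fun x => f (rho * cis x)));
    [|apply IH].
  intros x; apply E, Cmult_neq_0; [|apply cis_neq_0].
  intros E'; injection E'; lra.
Qed.

Lemma annulus_cis (r rho t : R) :
  (0 < r)%R -> (r <= rho <= 1)%R -> annulus r (rho * cis t).
Proof.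
intros Hr Hrho; unfold annulus.
rewrite Cmod_mult, Cmod_cis, Cmod_R, Rabs_pos_eq by lra; lra.
Qed.

Lemma approximable_continuous (r rho t : R) (f : C -> C) :
  (0 < r)%R -> (r <= rho <= 1)%R -> approximable r f ->
  @continuous R_UniformSpace C_RModule (fun x => f (rho * cis x)) t.
Proof.
intros Hr Hrho Hf; apply continuous_C_iff; intros eps.
assert (He : (0 < eps / 3)%R) by (destruct eps; simpl; lra).
destruct (Hf (eps / 3)%R He) as [p [Hp Ep]].
assert (Hc := proj1 (continuous_C_iff _ t)
  (laurent_continuous p rho t ltac:(lra) Hp) (mkposreal _ He)).
revert Hc; apply filter_imp; intros x Hx; simpl in Hx.
assert (H1 := Ep _ (annulus_cis r rho x Hr Hrho)).
assert (H2 := Ep _ (annulus_cis r rho t Hr Hrho)).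
replace (f (rho * cis x) - f (rho * cis t)) with
  ((f (rho * cis x) - p (rho * cis x)) + (p (rho * cis x) - p (rho * cis t))
   + - (f (rho * cis t) - p (rho * cis t))) by ring.
eapply Rle_lt_trans; [apply Cmod_triangle|].
eapply Rle_lt_trans; [apply Rplus_le_compat_r, Cmod_triangle|].
rewrite Cmod_opp; lra.
Qed.

Lemma is_RInt_Cmult (f : R -> C) (a b : R) (k l : C) :
  @is_RInt C_RModule f a b l -> @is_RInt C_RModule (fun t => k * f t) a b (k * l).
Proof.
intros H.
assert (H1 := is_RInt_fct_extend_fst (U := R_NormedModule) (V := R_NormedModule) f a b l H).
assert (H2 := is_RInt_fct_extend_snd (U := R_NormedModule) (V := R_NormedModule) f a b l H).
apply (is_RInt_fct_extend_pair (U := R_NormedModule) (V := R_NormedModule)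
  (fun t => k * f t) a b (fst k * fst l - snd k * snd l)%R
  (fst k * snd l + snd k * fst l)%R).
- simpl; apply (is_RInt_minus (V := R_NormedModule)).
  + exact (is_RInt_scal (V := R_NormedModule) _ _ _ (fst k) _ H1).
  + exact (is_RInt_scal (V := R_NormedModule) _ _ _ (snd k) _ H2).
- simpl; apply (is_RInt_plus (V := R_NormedModule)).
  + exact (is_RInt_scal (V := R_NormedModule) _ _ _ (fst k) _ H2).
  + exact (is_RInt_scal (V := R_NormedModule) _ _ _ (snd k) _ H1).
Qed.

Lemma is_RInt_Cconst (a b : R) (k : C) :
  @is_RInt C_RModule (fun _ => k) a b ((b - a)%R * k).
Proof.
replace ((b - a)%R * k) with (@scal R_AbsRing C_R_NormedModule (b - a)%R k).
- exact (is_RInt_const (V := C_R_NormedModule) a b k).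
- rewrite scal_R_Cmult; reflexivity.
Qed.

Lemma is_RInt_cos_PI (m n : nat) :
  m <> n -> @is_RInt C_RModule (fun t => RtoC (cos ((INR m - INR n) * t))) 0 PI (RtoC 0).
Proof.
intros Hmn; set (w := (INR m - INR n)%R).
assert (Hw : w <> 0%R).
{ unfold w; intros E; apply Hmn, INR_eq; lra. }
apply (is_RInt_fct_extend_pair (U := R_NormedModule) (V := R_NormedModule)
  (fun t => RtoC (cos (w * t))) 0 PI 0 0); simpl.
- evar_last.
  + apply (is_RInt_derive (V := R_CompleteNormedModule)
      (fun t => sin (w * t) / w)%R (fun t => cos (w * t))).
    * intros x _; auto_derive; [trivial|field; exact Hw].
    * intros x _; apply (ex_derive_continuous (V := R_NormedModule)).
      auto_derive; trivial.
  + simpl; unfold minus, plus, opp; simpl.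
    rewrite Rmult_0_r, sin_0.
    assert (E : sin (w * PI) = 0%R).
    { apply sin_eq_0_1; exists (Z.of_nat m - Z.of_nat n)%Z.
      now rewrite minus_IZR, <- !INR_IZR_INZ. }
    rewrite E; field; exact Hw.
- assert (H := is_RInt_const (V := R_NormedModule) 0 PI 0%R).
  unfold scal in H; simpl in H; unfold mult in H; simpl in H.
  rewrite Rmult_0_r in H; exact H.
Qed.

(** Only the monomials with equal exponents contribute, and these do not depend on the radius. *)
Lemma laurent_circle_integral (p : C -> C) :
  laurent p -> exists l : C, forall rho : R, (0 < rho)%R ->
    @is_RInt C_RModule (fun t => p (rho * cis t) + p (rho * cis (- t))) 0 PI l.
Proof.
intros Hp; induction Hp as [c m n|f g _ IH1 _ IH2|f g E _ IH].
- assert (H : forall rho t : R, (0 < rho)%R ->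
    (c * rho ^ m * (/ rho) ^ n * 2) * RtoC (cos ((INR m - INR n) * t)) =
    c * (rho * cis t) ^ m * (/ (rho * cis t)) ^ n +
    c * (rho * cis (- t)) ^ m * (/ (rho * cis (- t))) ^ n).
  { intros rho t Hrho; rewrite !monomial_cis by exact Hrho.
    replace ((INR m - INR n) * - t)%R with (- ((INR m - INR n) * t))%R by ring.
    set (w := ((INR m - INR n) * t)%R).
    unfold cis, RtoC, Cmult, Cplus; simpl.
    rewrite cos_neg, sin_neg; f_equal; ring. }
  destruct (Nat.eq_dec m n) as [Emn|Hmn].
  + exists ((PI - 0)%R * (2 * c)); intros rho Hrho.
    assert (Hr : RtoC rho <> 0) by (intros E; injection E; lra).
    eapply (is_RInt_ext (V := C_RModule)); [|apply is_RInt_Cconst].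
    intros x _; cbv beta; rewrite <- H by exact Hrho; rewrite Emn.
    rewrite Rminus_diag, Rmult_0_l, cos_0, Cpow_inv by exact Hr.
    C_eq; field; now apply Cpow_nz.
  + exists (RtoC 0); intros rho Hrho.
    eapply (is_RInt_ext (V := C_RModule)); [intros x _; exact (H rho x Hrho)|].
    rewrite <- (Cmult_0_r (c * rho ^ m * (/ rho) ^ n * 2)).
    apply is_RInt_Cmult, is_RInt_cos_PI, Hmn.
- destruct IH1 as [l1 H1], IH2 as [l2 H2].
  exists (l1 + l2); intros rho Hrho.
  eapply (is_RInt_ext (V := C_RModule)); [|exact (is_RInt_plus (V := C_RModule) _ _ _ _ _ _
    (H1 rho Hrho) (H2 rho Hrho))].
  intros x _.
  change (f (rho * cis x) + f (rho * cis (- x)) +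
          (g (rho * cis x) + g (rho * cis (- x))) =
          f (rho * cis x) + g (rho * cis x) +
          (f (rho * cis (- x)) + g (rho * cis (- x)))); ring.
- destruct IH as [l H]; exists l; intros rho Hrho.
  assert (Hr : RtoC rho <> 0) by (intros E'; injection E'; lra).
  eapply (is_RInt_ext (V := C_RModule)); [|exact (H rho Hrho)].
  intros x _; cbv beta.
  now rewrite !E by (apply Cmult_neq_0; [exact Hr|apply cis_neq_0]).
Qed.

Lemma Cmod_is_RInt_sub_le (f g : R -> C) (l m : C) (M : R) :
  @is_RInt C_RModule f 0 PI l -> @is_RInt C_RModule g 0 PI m ->
  (forall t, (Cmod (f t - g t) <= M)%R) -> (Cmod (l - m) <= PI * M)%R.
Proof.
intros Hf Hg H.
assert (H1 := is_RInt_minus (V := C_RModule) _ _ _ _ _ _ Hf Hg).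
assert (H2 := norm_RInt_le_const (V := C_R_NormedModule) _ 0 PI _ M
  (Rlt_le _ _ PI_RGT_0) (fun t _ => eq_ind _ (fun x => (x <= M)%R) (H t) _
    (Cmod_norm _)) H1).
rewrite Rminus_0_r in H2; rewrite Cmod_norm; exact H2.
Qed.

Lemma eq_of_Cmod_le (x y : C) (M : R) :
  (forall eps, (0 < eps)%R -> (Cmod (x - y) <= M * eps)%R) -> x = y.
Proof.
intros H.
assert (E : (Cmod (x - y) <= 0)%R).
{ apply (is_lim_seq_le (fun _ => Cmod (x - y))
    (fun n => M * (/ 2) ^ n)%R (Cmod (x - y)) 0%R).
  - intros n; apply H, pow_lt; lra.
  - apply is_lim_seq_const.
  - apply is_lim_geom; lra. }
assert (E' : x - y = 0) by (apply Cmod_eq_0, Rle_antisym; [exact E|apply Cmod_ge_0]).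
replace x with ((x - y) + y) by ring; rewrite E'; ring.
Qed.

(** The integral over the full circle, folded onto the upper half so that it compares directly
    with integrals over 0 <= theta <= pi. *)
Definition symmetric_integral (f : C -> C) : C :=
  @RInt C_RModule (fun t => f (cis t) + f (cis (- t))) 0 PI.

Lemma continuous_opp_arg (f : R -> C) (t : R) :
  (forall x, @continuous R_UniformSpace C_RModule f x) ->
  @continuous R_UniformSpace C_RModule (fun x => f (- x)%R) t.
Proof.
intros H; apply (@continuous_comp R_UniformSpace R_UniformSpace C_RModule Ropp f).
- apply (continuous_opp (fun x : R => x)); apply continuous_id.
- apply H.
Qed.

Lemma approximable_ex_RInt (r rho : R) (f : C -> C) :
  (0 < r)%R -> (r <= rho <= 1)%R -> approximable r f ->
  @ex_RInt C_RModule (fun t => f (rho * cis t) + f (rho * cis (- t))) 0 PI.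
Proof.
intros Hr Hrho Hf; apply (ex_RInt_continuous (V := C_RModule)); intros t _.
apply (@continuous_plus R_UniformSpace R_AbsRing C_R_NormedModule).
- now apply approximable_continuous with r.
- apply (continuous_opp_arg (fun x => f (rho * cis x))); intros x.
  now apply approximable_continuous with r.
Qed.

(** Cauchy's theorem on the annulus q <= |z| <= 1: it holds exactly for Laurent polynomials, and
    both sides depend continuously on f for uniform convergence on the two circles. *)
Lemma symmetric_integral_dilation (q : R) (f : C -> C) :
  (0 < q <= 1)%R -> approximable q f ->
  symmetric_integral (fun z => f (q * z)) = symmetric_integral f.
Proof.
intros Hq Hf.
assert (I1 := RInt_correct (V := C_RModule) _ _ _
  (approximable_ex_RInt q q f ltac:(lra) ltac:(lra) Hf)).
assert (I2 := RInt_correct (V := C_RModule) _ _ _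
  (approximable_ex_RInt q 1 f ltac:(lra) ltac:(lra) Hf)).
fold (symmetric_integral (fun z => f (q * z))) in I1.
replace (@RInt C_RModule (fun t => f (1 * cis t) + f (1 * cis (- t))) 0 PI)
  with (symmetric_integral f) in I2.
2: { apply (RInt_ext (V := C_RModule)); intros x _; now rewrite !Cmult_1_l. }
apply eq_of_Cmod_le with (PI * 4)%R; intros eps Heps.
destruct (Hf eps Heps) as [p [Hp Ep]].
destruct (laurent_circle_integral p Hp) as [l Hl].
assert (H : forall rho L, (q <= rho <= 1)%R ->
  @is_RInt C_RModule (fun t => f (rho * cis t) + f (rho * cis (- t))) 0 PI L ->
  (Cmod (L - l) <= PI * (2 * eps))%R).
{ intros rho L Hrho HL.
  eapply Cmod_is_RInt_sub_le; [exact HL|apply (Hl rho); lra|].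
  intros t; cbv beta.
  replace (f (rho * cis t) + f (rho * cis (- t)) -
    (p (rho * cis t) + p (rho * cis (- t)))) with
   ((f (rho * cis t) - p (rho * cis t)) +
    (f (rho * cis (- t)) - p (rho * cis (- t)))) by ring.
  eapply Rle_trans; [apply Cmod_triangle|].
  assert (H1 := Ep _ (annulus_cis q rho t ltac:(lra) Hrho)).
  assert (H2 := Ep _ (annulus_cis q rho (- t) ltac:(lra) Hrho)); lra. }
assert (H1 := H q _ ltac:(lra) I1); assert (H2 := H 1%R _ ltac:(lra) I2).
replace (symmetric_integral (fun z => f (q * z)) - symmetric_integral f) with
  ((symmetric_integral (fun z => f (q * z)) - l) + - (symmetric_integral f - l))
  by ring.
eapply Rle_trans; [apply Cmod_triangle|]; rewrite Cmod_opp; lra.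
Qed.

(** * Integrals over the upper unit semicircle *)

Definition arc_integral (f : C -> C) : C := @RInt C_RModule (fun t => f (cis t)) 0 PI.

Lemma approximable_arc_ex_RInt (f : C -> C) :
  approximable 1 f -> @ex_RInt C_RModule (fun t => f (cis t)) 0 PI.
Proof.
intros Hf; apply (ex_RInt_continuous (V := C_RModule)); intros t _.
apply (@continuous_ext R_UniformSpace C_RModule (fun x => f (1%R * cis x))).
- intros x; now rewrite Cmult_1_l.
- apply approximable_continuous with 1%R; trivial; lra.
Qed.

Lemma arc_integral_correct (f : C -> C) :
  approximable 1 f -> @is_RInt C_RModule (fun t => f (cis t)) 0 PI (arc_integral f).
Proof.
intros Hf; apply (RInt_correct (V := C_RModule)); now apply approximable_arc_ex_RInt.
Qed.

Lemma arc_integral_ext (f g : C -> C) :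
  (forall t, f (cis t) = g (cis t)) -> arc_integral f = arc_integral g.
Proof. intros E; apply (RInt_ext (V := C_RModule)); intros t _; apply E. Qed.

Lemma arc_integral_scal (k : C) (f : C -> C) :
  approximable 1 f -> arc_integral (fun z => k * f z) = k * arc_integral f.
Proof.
intros Hf; apply (is_RInt_unique (V := C_RModule)), is_RInt_Cmult.
now apply arc_integral_correct.
Qed.

Lemma arc_integral_plus (f g : C -> C) :
  approximable 1 f -> approximable 1 g ->
  arc_integral (fun z => f z + g z) = arc_integral f + arc_integral g.
Proof.
intros Hf Hg; apply (is_RInt_unique (V := C_RModule)).
apply (is_RInt_plus (V := C_RModule)); now apply arc_integral_correct.
Qed.

Lemma inv_qpoch_inf_shift (q : R) (x : C) :
  (0 < q < 1)%R -> (Cmod x < 1)%R ->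
  / qpoch_inf (x * q) q = (1 - x) * / qpoch_inf x q.
Proof.
intros Hq Hx; rewrite (qpoch_inf_shift q x Hq).
assert (Hx1 := one_minus_neq_0 x Hx).
assert (H := qpoch_inf_neq_0 q x Hq Hx).
field; split; [|exact Hx1].
intros E; apply H; rewrite (qpoch_inf_shift q x Hq), E; ring.
Qed.

(** * The kernel and the first moment *)

Definition aw_inv_factor (q : R) (a z : C) : C :=
  / qpoch_inf (a * z) q * / qpoch_inf (a * / z) q.

Definition aw_inv_factors (q : R) (a b c d z : C) : C :=
  aw_inv_factor q a z * aw_inv_factor q b z * aw_inv_factor q c z * aw_inv_factor q d z.

(** The weight as a function of z = e^{i theta}; products of inverses are used because each
    factor is separately [approximable]. *)
Definition aw_weight_z (q : R) (a b c d z : C) : C :=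
  qpoch_inf (z * z) q * qpoch_inf (/ z * / z) q * aw_inv_factors q a b c d z.

(** On the unit circle, away from z = 1 and z = -1, this function F is
    z^3 (1 - a/z)(1 - b/z)(1 - c/z)(1 - d/z) W(z) / (1 - z^2).  The four linear factors push the
    poles of W in the unit disk into |z| < q, and z^3 is the power for which F(q z) = - F(1/z). *)
Definition aw_kernel (q : R) (a b c d z : C) : C :=
  z * z * z * qpoch_inf (z * z * q) q * qpoch_inf (/ z * / z) q *
  ((/ qpoch_inf (a * z) q * / qpoch_inf (a * / z * q) q) *
   (/ qpoch_inf (b * z) q * / qpoch_inf (b * / z * q) q) *
   (/ qpoch_inf (c * z) q * / qpoch_inf (c * / z * q) q) *
   (/ qpoch_inf (d * z) q * / qpoch_inf (d * / z * q) q)).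

Lemma approximable_sq (r : R) :
  (0 < r)%R -> approximable r (fun z => z * z).
Proof. intros Hr; apply approximable_mult; trivial; apply approximable_id. Qed.

Lemma approximable_inv_sq (r : R) :
  (0 < r)%R -> approximable r (fun z => / z * / z).
Proof. intros Hr; apply approximable_mult; trivial; apply approximable_inv_id. Qed.

Lemma approximable_scal_id (r : R) (a : C) :
  (0 < r)%R -> approximable r (fun z => a * z).
Proof.
intros Hr; apply approximable_mult; [exact Hr|apply approximable_const|].
apply approximable_id.
Qed.

Lemma approximable_scal_inv (r : R) (a : C) :
  (0 < r)%R -> approximable r (fun z => a * / z).
Proof.
intros Hr; apply approximable_mult; [exact Hr|apply approximable_const|].
apply approximable_inv_id.
Qed.

Lemma approximable_inv_qpoch_inf_scal (q r : R) (a : C) :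
  (0 < q < 1)%R -> (0 < r)%R -> (Cmod a < 1)%R ->
  approximable r (fun z => / qpoch_inf (a * z) q).
Proof.
intros Hq Hr Ha; assert (H0 := Cmod_ge_0 a).
(* The midpoint of |a| and 1 stays positive when a = 0. *)
apply approximable_inv_qpoch_inf with ((1 + Cmod a) / 2)%R; try lra.
- now apply approximable_scal_id.
- intros z Hz; rewrite Cmod_mult.
  apply Rle_trans with (Cmod a * 1)%R; [|lra].
  apply Rmult_le_compat_l; [exact H0|apply Hz].
Qed.

Lemma Cmod_div_annulus (r : R) (a z : C) :
  (0 < r)%R -> annulus r z -> (Cmod (a * / z) * r <= Cmod a)%R.
Proof.
intros Hr Hz; assert (Hz0 := annulus_neq_0 r z Hr Hz).
rewrite Cmod_mult, Cmod_inv by exact Hz0; rewrite Rmult_assoc.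
rewrite <- (Rmult_1_r (Cmod a)) at 2.
apply Rmult_le_compat_l; [apply Cmod_ge_0|].
destruct Hz as [Hz _]; apply Rmult_le_reg_l with (Cmod z); [lra|].
rewrite <- Rmult_assoc, Rinv_r by lra; lra.
Qed.

Lemma approximable_inv_qpoch_inf_scal_inv (q r s : R) (a : C) :
  (0 < q < 1)%R -> (0 < s <= r)%R -> (Cmod a < 1)%R ->
  approximable r (fun z => / qpoch_inf (a * / z * s) q).
Proof.
intros Hq Hs Ha; assert (H0 := Cmod_ge_0 a).
apply approximable_inv_qpoch_inf with ((1 + Cmod a) / 2)%R; try lra.
- apply approximable_mult; [lra| |apply approximable_const].
  apply approximable_scal_inv; lra.
- intros z Hz; rewrite Cmod_mult, Cmod_R, Rabs_pos_eq by lra.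
  assert (H := Cmod_div_annulus r a z ltac:(lra) Hz).
  apply Rle_trans with (Cmod (a * / z) * r)%R; [|lra].
  apply Rmult_le_compat_l; [apply Cmod_ge_0|lra].
Qed.

Lemma approximable_aw_inv_factor (q : R) (a : C) :
  (0 < q < 1)%R -> (Cmod a < 1)%R -> approximable 1 (aw_inv_factor q a).
Proof.
intros Hq Ha; apply approximable_mult; [lra|apply approximable_inv_qpoch_inf_scal; lra|].
apply approximable_ext with (fun z => / qpoch_inf (a * / z * 1%R) q).
- intros z _; now rewrite Cmult_1_r.
- apply approximable_inv_qpoch_inf_scal_inv; lra.
Qed.

Lemma approximable_aw_weight (q : R) (a b c d : C) :
  (0 < q < 1)%R ->
  (Cmod a < 1)%R -> (Cmod b < 1)%R -> (Cmod c < 1)%R -> (Cmod d < 1)%R ->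
  approximable 1 (aw_weight_z q a b c d).
Proof.
intros Hq Ha Hb Hc Hd; unfold aw_weight_z, aw_inv_factors.
assert (H1 : (0 < 1)%R) by lra.
apply approximable_mult; [exact H1| |].
- apply approximable_mult; [exact H1| |];
    (apply approximable_qpoch_inf; [exact Hq|exact H1|]).
  + now apply approximable_sq.
  + now apply approximable_inv_sq.
- do 3 (apply approximable_mult; [exact H1| |now apply approximable_aw_inv_factor]).
  now apply approximable_aw_inv_factor.
Qed.

Lemma approximable_aw_kernel (q : R) (a b c d : C) :
  (0 < q < 1)%R ->
  (Cmod a < 1)%R -> (Cmod b < 1)%R -> (Cmod c < 1)%R -> (Cmod d < 1)%R ->
  approximable q (aw_kernel q a b c d).
Proof.
intros Hq Ha Hb Hc Hd; unfold aw_kernel.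
assert (H1 : (0 < q)%R) by lra.
assert (HP : forall x, (Cmod x < 1)%R -> approximable q
  (fun z => / qpoch_inf (x * z) q * / qpoch_inf (x * / z * q) q)).
{ intros x Hx; apply approximable_mult; [exact H1| |].
  - now apply approximable_inv_qpoch_inf_scal.
  - apply approximable_inv_qpoch_inf_scal_inv; lra. }
apply approximable_mult; [exact H1| |].
- repeat (apply approximable_mult; [exact H1| |]);
    try apply approximable_id; apply approximable_qpoch_inf; trivial.
  + apply approximable_mult; [exact H1|now apply approximable_sq|].
    apply approximable_const.
  + now apply approximable_inv_sq.
- do 3 (apply approximable_mult; [exact H1| |now apply HP]).
  now apply HP.
Qed.

(** The factors common to the weight and to the kernel at z, 1/z and q z.  Splitting off
    1 - z^2 and 1 - 1/z^2 avoids a division by zero at z = 1 and z = -1. *)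
Definition aw_core (q : R) (a b c d z : C) : C :=
  qpoch_inf (z * z * q) q * qpoch_inf (/ z * / z * q) q * aw_inv_factors q a b c d z.

Lemma Cmod_on_circle (a z : C) :
  (Cmod a < 1)%R -> Cmod z = 1%R ->
  (Cmod (a * z) < 1)%R /\ (Cmod (a * / z) < 1)%R.
Proof.
intros Ha Hz; assert (Hz0 : z <> 0) by (intros E; rewrite E, Cmod_0 in Hz; lra).
rewrite !Cmod_mult, Cmod_inv, Hz by exact Hz0; split; lra.
Qed.

Lemma aw_kernel_on_circle (q : R) (a b c d z : C) :
  (0 < q < 1)%R ->
  (Cmod a < 1)%R -> (Cmod b < 1)%R -> (Cmod c < 1)%R -> (Cmod d < 1)%R ->
  Cmod z = 1%R ->
  aw_kernel q a b c d z = aw_core q a b c d z * (z * z * z * (1 - / z * / z) *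
    ((1 - a * / z) * (1 - b * / z) * (1 - c * / z) * (1 - d * / z))).
Proof.
intros Hq Ha Hb Hc Hd Hz; unfold aw_kernel, aw_core, aw_inv_factors, aw_inv_factor.
rewrite (qpoch_inf_shift q (/ z * / z) Hq).
rewrite !inv_qpoch_inf_shift by (trivial; now apply Cmod_on_circle).
ring.
Qed.

Lemma aw_core_inv (q : R) (a b c d z : C) :
  z <> 0 -> aw_core q a b c d (/ z) = aw_core q a b c d z.
Proof.
intros Hz; unfold aw_core, aw_inv_factors, aw_inv_factor.
replace (/ / z) with z by (field; exact Hz); ring.
Qed.

(** Dilation changes each infinite product by finitely many factors, so after the shifts only a
    rational identity is left. *)
Lemma aw_kernel_dilated (q : R) (a b c d z : C) :
  (0 < q < 1)%R ->
  (Cmod a < 1)%R -> (Cmod b < 1)%R -> (Cmod c < 1)%R -> (Cmod d < 1)%R ->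
  Cmod z = 1%R ->
  aw_kernel q a b c d (q * z) = - aw_kernel q a b c d (/ z).
Proof.
intros Hq Ha Hb Hc Hd Hz.
assert (Hz0 : z <> 0) by (intros E; rewrite E, Cmod_0 in Hz; lra).
assert (Hq0 : RtoC q <> 0) by (intros E; injection E; lra).
assert (Hiz : Cmod (/ z) = 1%R) by (rewrite Cmod_inv, Hz by exact Hz0; field).
rewrite (aw_kernel_on_circle q a b c d (/ z)), aw_core_inv by trivial.
replace (/ / z) with z by (field; exact Hz0).
unfold aw_kernel, aw_core, aw_inv_factors, aw_inv_factor.
set (X := / (q * z) * / (q * z)).
replace (a * / (q * z) * q) with (a * / z) by (field; now split).
replace (b * / (q * z) * q) with (b * / z) by (field; now split).
replace (c * / (q * z) * q) with (c * / z) by (field; now split).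
replace (d * / (q * z) * q) with (d * / z) by (field; now split).
replace (a * (q * z)) with (a * z * q) by ring.
replace (b * (q * z)) with (b * z * q) by ring.
replace (c * (q * z)) with (c * z * q) by ring.
replace (d * (q * z)) with (d * z * q) by ring.
rewrite !inv_qpoch_inf_shift by (trivial; now apply Cmod_on_circle).
rewrite (qpoch_inf_shift q X Hq), (qpoch_inf_shift q (X * q) Hq),
  (qpoch_inf_shift q (X * q * q) Hq).
rewrite (qpoch_inf_shift q (z * z * q) Hq),
  (qpoch_inf_shift q (z * z * q * q) Hq).
replace (q * z * (q * z) * q) with (z * z * q * q * q) by ring.
replace (X * q * q * q) with (/ z * / z * q) by (unfold X; field; now split).
set (A := qpoch_inf (z * z * q * q * q) q).
set (B := qpoch_inf (/ z * / z * q) q).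
(* The factors left over are abstract: what remains is a rational identity. *)
generalize (/ qpoch_inf (a * z) q) (/ qpoch_inf (b * z) q)
  (/ qpoch_inf (c * z) q) (/ qpoch_inf (d * z) q) (/ qpoch_inf (a * / z) q)
  (/ qpoch_inf (b * / z) q) (/ qpoch_inf (c * / z) q) (/ qpoch_inf (d * / z) q).
intros; unfold X; field; now split.
Qed.

(** In the sum the coefficients of the quartic with roots a, b, c, d pair up, and 1 - z^2
    divides the result. *)
Lemma aw_kernel_symmetrized (q : R) (a b c d z : C) :
  (0 < q < 1)%R ->
  (Cmod a < 1)%R -> (Cmod b < 1)%R -> (Cmod c < 1)%R -> (Cmod d < 1)%R ->
  Cmod z = 1%R ->
  aw_kernel q a b c d z + aw_kernel q a b c d (/ z) =
  (a + b + c + d - a * b * c - a * b * d - a * c * d - b * c * d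
   - (1 - a * b * c * d) * (z + / z)) * aw_weight_z q a b c d z.
Proof.
intros Hq Ha Hb Hc Hd Hz.
assert (Hz0 : z <> 0) by (intros E; rewrite E, Cmod_0 in Hz; lra).
assert (Hiz : Cmod (/ z) = 1%R) by (rewrite Cmod_inv, Hz by exact Hz0; field).
rewrite !aw_kernel_on_circle, aw_core_inv by trivial.
unfold aw_weight_z.
rewrite (qpoch_inf_shift q (z * z) Hq), (qpoch_inf_shift q (/ z * / z) Hq).
unfold aw_core; set (D := aw_inv_factors q a b c d z).
set (A := qpoch_inf (z * z * q) q).
set (B := qpoch_inf (/ z * / z * q) q).
field; exact Hz0.
Qed.

(** The integral equals its own opposite. *)
Lemma symmetric_integral_aw_kernel (q : R) (a b c d : C) :
  (0 < q < 1)%R ->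
  (Cmod a < 1)%R -> (Cmod b < 1)%R -> (Cmod c < 1)%R -> (Cmod d < 1)%R ->
  symmetric_integral (aw_kernel q a b c d) = 0.
Proof.
intros Hq Ha Hb Hc Hd; set (F := aw_kernel q a b c d).
assert (HF : approximable q F) by now apply approximable_aw_kernel.
(* The integral of F(q z) is that of F by dilation, and its opposite by z -> 1/z. *)
assert (H1 := symmetric_integral_dilation q F ltac:(lra) HF).
assert (HE := approximable_ex_RInt q 1 F ltac:(lra) ltac:(lra) HF).
assert (H2 : symmetric_integral (fun z => F (q * z)) =
  (- (1)) * symmetric_integral F).
{ apply (is_RInt_unique (V := C_RModule)).
  eapply (is_RInt_ext (V := C_RModule)); [|apply is_RInt_Cmult].
  2: { apply (RInt_correct (V := C_RModule)).
       eapply (ex_RInt_ext (V := C_RModule)); [|exact HE].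
       intros t _; cbv beta; now rewrite !Cmult_1_l. }
  intros t _; cbv beta; unfold F.
  rewrite !aw_kernel_dilated by (trivial; apply Cmod_cis).
  rewrite !cis_inv, Ropp_involutive; C_eq; ring. }
rewrite H1 in H2.
replace (symmetric_integral F)
  with (/ 2 * (symmetric_integral F - (- (1)) * symmetric_integral F)).
- rewrite <- H2; ring.
- field; intros E; injection E; lra.
Qed.

Lemma aw_first_moment (q : R) (a b c d : C) :
  (0 < q < 1)%R ->
  (Cmod a < 1)%R -> (Cmod b < 1)%R -> (Cmod c < 1)%R -> (Cmod d < 1)%R ->
  arc_integral (fun z =>
    (a + b + c + d - a * b * c - a * b * d - a * c * d - b * c * d
     - (1 - a * b * c * d) * (z + / z)) * aw_weight_z q a b c d z) = 0.
Proof.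
intros Hq Ha Hb Hc Hd.
rewrite <- (symmetric_integral_aw_kernel q a b c d) by trivial.
apply (RInt_ext (V := C_RModule)); intros t _; cbv beta.
rewrite <- (cis_inv t), aw_kernel_symmetrized by (trivial; apply Cmod_cis).
reflexivity.
Qed.

Lemma Cmod_mult_lt_1 (x y : C) :
  (Cmod x < 1)%R -> (Cmod y < 1)%R -> (Cmod (x * y) < 1)%R.
Proof.
intros Hx Hy; rewrite Cmod_mult.
assert (H := Cmod_ge_0 x); assert (H' := Cmod_ge_0 y); nra.
Qed.

Lemma Cmod_mult_q_lt_1 (q : R) (x : C) :
  (0 < q < 1)%R -> (Cmod x < 1)%R -> (Cmod (x * q) < 1)%R.
Proof.
intros Hq Hx; apply Cmod_mult_lt_1; [exact Hx|].
rewrite Cmod_R, Rabs_pos_eq; lra.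
Qed.

(** * The Askey-Wilson integral up to a constant *)

Definition aw_integral (q : R) (a b c d : C) : C :=
  arc_integral (aw_weight_z q a b c d).

Lemma aw_weight_shift (q : R) (a b c d z : C) :
  (0 < q < 1)%R -> (Cmod a < 1)%R -> Cmod z = 1%R ->
  aw_weight_z q (a * q) b c d z =
  (1 - a * z) * (1 - a * / z) * aw_weight_z q a b c d z.
Proof.
intros Hq Ha Hz; unfold aw_weight_z, aw_inv_factors, aw_inv_factor.
replace (a * q * z) with (a * z * q) by ring.
replace (a * q * / z) with (a * / z * q) by ring.
rewrite !inv_qpoch_inf_shift by (trivial; now apply Cmod_on_circle).
ring.
Qed.

(** W(z; aq, b, c, d) = (1 + a^2 - 2 a cos theta) W(z; a, b, c, d), and the first moment of W is
    known. *)
Lemma aw_integral_shift (q : R) (a b c d : C) :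
  (0 < q < 1)%R ->
  (Cmod a < 1)%R -> (Cmod b < 1)%R -> (Cmod c < 1)%R -> (Cmod d < 1)%R ->
  (1 - a * b * c * d) * aw_integral q (a * q) b c d =
  (1 - a * b) * (1 - a * c) * (1 - a * d) * aw_integral q a b c d.
Proof.
intros Hq Ha Hb Hc Hd; unfold aw_integral.
assert (HW : approximable 1 (aw_weight_z q a b c d))
  by now apply approximable_aw_weight.
rewrite <- !arc_integral_scal.
3: { apply approximable_aw_weight; trivial; now apply Cmod_mult_q_lt_1. }
2: exact HW.
assert (H1 : (0 < 1)%R) by lra.
set (L := fun z => (a + b + c + d - a * b * c - a * b * d - a * c * d
  - b * c * d - (1 - a * b * c * d) * (z + / z)) * aw_weight_z q a b c d z).
assert (HL : approximable 1 L).
{ apply approximable_mult; [exact H1| |exact HW].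
  apply approximable_ext with (fun z =>
    (a + b + c + d - a * b * c - a * b * d - a * c * d - b * c * d)
    + (- (1 - a * b * c * d)) * (z + / z)); [intros z _; ring|].
  apply approximable_plus; [apply approximable_const|].
  apply approximable_mult; [exact H1|apply approximable_const|].
  apply approximable_plus; [apply approximable_id|apply approximable_inv_id]. }
rewrite (arc_integral_ext _ (fun z =>
  (1 - a * b) * (1 - a * c) * (1 - a * d) * aw_weight_z q a b c d z + a * L z)).
- rewrite arc_integral_plus.
  + rewrite (arc_integral_scal a L HL); unfold L at 1.
    rewrite aw_first_moment by trivial; ring.
  + apply approximable_mult; [exact H1|apply approximable_const|exact HW].
  + apply approximable_mult; [exact H1|apply approximable_const|exact HL].
- intros t; rewrite aw_weight_shift by (trivial; apply Cmod_cis).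
  unfold L; field; apply cis_neq_0.
Qed.

Lemma Cmod_mult_pow_lt_1 (q : R) (x : C) (n : nat) :
  (0 < q < 1)%R -> (Cmod x < 1)%R -> (Cmod (x * q ^ n) < 1)%R.
Proof. intros Hq Hx; eapply Rle_lt_trans; [now apply Cmod_mult_qpow|exact Hx]. Qed.

Lemma aw_integral_iter (q : R) (a b c d : C) (n : nat) :
  (0 < q < 1)%R ->
  (Cmod a < 1)%R -> (Cmod b < 1)%R -> (Cmod c < 1)%R -> (Cmod d < 1)%R ->
  qpoch (a * b * c * d) q n * aw_integral q (a * q ^ n) b c d =
  qpoch (a * b) q n * qpoch (a * c) q n * qpoch (a * d) q n *
  aw_integral q a b c d.
Proof.
intros Hq Ha Hb Hc Hd; induction n as [|n IH].
- simpl; rewrite Cmult_1_r; ring.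
- assert (H := aw_integral_shift q (a * q ^ n) b c d Hq
    (Cmod_mult_pow_lt_1 q a n Hq Ha) Hb Hc Hd).
  replace (a * q ^ n * q) with (a * q ^ S n) in H by (rewrite Cpow_S; ring).
  simpl qpoch.
  transitivity (qpoch (a * b * c * d) q n *
    ((1 - a * q ^ n * b * c * d) * aw_integral q (a * q ^ S n) b c d)); [ring|].
  rewrite H.
  transitivity ((1 - a * b * q ^ n) * (1 - a * c * q ^ n) * (1 - a * d * q ^ n) *
    (qpoch (a * b * c * d) q n * aw_integral q (a * q ^ n) b c d)); [ring|].
  rewrite IH; ring.
Qed.

Lemma aw_weight_iter (q : R) (a b c d z : C) (n : nat) :
  (0 < q < 1)%R -> (Cmod a < 1)%R -> Cmod z = 1%R ->
  aw_weight_z q (a * q ^ n) b c d z =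
  qpoch (a * z) q n * qpoch (a * / z) q n * aw_weight_z q a b c d z.
Proof.
intros Hq Ha Hz; induction n as [|n IH].
- simpl; rewrite Cmult_1_r; ring.
- replace (a * q ^ S n) with (a * q ^ n * q) by (rewrite Cpow_S; ring).
  rewrite aw_weight_shift by (trivial; now apply Cmod_mult_pow_lt_1).
  rewrite IH; simpl; ring.
Qed.

(** The parameter 0 is reached by multiplying with (az, a/z; q)_oo, the uniform limit of the
    factors in [aw_weight_iter]. *)
Lemma aw_weight_zero (q : R) (a b c d z : C) :
  (0 < q < 1)%R -> (Cmod a < 1)%R -> Cmod z = 1%R ->
  aw_weight_z q 0 b c d z =
  qpoch_inf (a * z) q * qpoch_inf (a * / z) q * aw_weight_z q a b c d z.
Proof.
intros Hq Ha Hz; unfold aw_weight_z, aw_inv_factors.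
replace (aw_inv_factor q 0 z) with (RtoC 1).
2: { unfold aw_inv_factor; rewrite !Cmult_0_l, qpoch_inf_0; field; exact C1_nz. }
unfold aw_inv_factor at 4; destruct (Cmod_on_circle a z Ha Hz) as [H1 H2].
assert (N1 := qpoch_inf_neq_0 q _ Hq H1).
assert (N2 := qpoch_inf_neq_0 q _ Hq H2).
field; now split.
Qed.

Lemma qpoch_product_rate (q : R) (x y : C) (n : nat) :
  (0 < q < 1)%R -> (Cmod x <= 1)%R -> (Cmod y <= 1)%R ->
  let G := geom_bound q 1 in
  (Cmod (qpoch x q n * qpoch y q n - qpoch_inf x q * qpoch_inf y q)
   <= (3 * G + 2) * G * q ^ n)%R.
Proof.
intros Hq Hx Hy G.
assert (HG : (0 <= G)%R) by (apply geom_bound_ge_0; lra).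
assert (Hn : (0 <= q ^ n <= 1)%R).
{ split; [apply pow_le; lra|rewrite <- (pow1 n); apply pow_incr; lra]. }
assert (HI : forall w, (Cmod w <= 1)%R -> (Cmod (qpoch_inf w q) <= G + 1)%R).
{ intros w Hw; assert (H := qpoch_rate q 1 w 0 Hq Hw); fold G in H; simpl in H.
  replace (qpoch_inf w q) with (- (1 - qpoch_inf w q) + 1) by ring.
  eapply Rle_trans; [apply Cmod_triangle|]; rewrite Cmod_opp, Cmod_1; lra. }
assert (Rx := qpoch_rate q 1 x n Hq Hx); assert (Ry := qpoch_rate q 1 y n Hq Hy).
fold G in Rx, Ry.
assert (Bx := HI x Hx); assert (By := HI y Hy).
assert (Bn : (Cmod (qpoch x q n) <= 2 * G + 1)%R).
{ replace (qpoch x q n) with ((qpoch x q n - qpoch_inf x q) + qpoch_inf x q) by ring.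
  eapply Rle_trans; [apply Cmod_triangle|]; nra. }
replace (qpoch x q n * qpoch y q n - qpoch_inf x q * qpoch_inf y q) with
  (qpoch x q n * (qpoch y q n - qpoch_inf y q) +
   qpoch_inf y q * (qpoch x q n - qpoch_inf x q)) by ring.
eapply Rle_trans; [apply Cmod_triangle|]; rewrite !Cmod_mult.
replace ((3 * G + 2) * G * q ^ n)%R with
  ((2 * G + 1) * (G * q ^ n) + (G + 1) * (G * q ^ n))%R by ring.
apply Rplus_le_compat; apply Rmult_le_compat; trivial; apply Cmod_ge_0.
Qed.

(** The integrands converge uniformly, since (az, a/z; q)_n does and W is bounded. *)
Lemma aw_integral_lim (q : R) (a b c d : C) :
  (0 < q < 1)%R ->
  (Cmod a < 1)%R -> (Cmod b < 1)%R -> (Cmod c < 1)%R -> (Cmod d < 1)%R ->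
  Clim (fun n => aw_integral q (a * q ^ n) b c d) (aw_integral q 0 b c d).
Proof.
intros Hq Ha Hb Hc Hd.
assert (H1 : (0 < 1)%R) by lra.
assert (HW : approximable 1 (aw_weight_z q a b c d))
  by now apply approximable_aw_weight.
destruct (approximable_bounded 1 _ H1 HW) as [M [HM BM]].
set (G := geom_bound q 1).
assert (HG : (0 <= G)%R) by (apply geom_bound_ge_0; lra).
apply Clim_squeeze with (fun n => PI * ((3 * G + 2) * G * M) * q ^ n)%R;
  [|now apply is_lim_geom].
intros n; rewrite Rmult_assoc.
eapply Cmod_is_RInt_sub_le.
- apply arc_integral_correct, approximable_aw_weight; trivial.
  now apply Cmod_mult_pow_lt_1.
- apply arc_integral_correct, approximable_aw_weight; trivial.
  rewrite Cmod_0; lra.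
- intros t; cbv beta.
  rewrite aw_weight_iter by (trivial; apply Cmod_cis).
  rewrite (aw_weight_zero q a) by (trivial; apply Cmod_cis).
  set (z := cis t); set (w := aw_weight_z q a b c d z).
  replace (qpoch (a * z) q n * qpoch (a * / z) q n * w -
    qpoch_inf (a * z) q * qpoch_inf (a * / z) q * w) with
   ((qpoch (a * z) q n * qpoch (a * / z) q n -
    qpoch_inf (a * z) q * qpoch_inf (a * / z) q) * w) by ring.
  rewrite Cmod_mult.
  destruct (Cmod_on_circle a z Ha (Cmod_cis t)) as [B1 B2].
  replace ((3 * G + 2) * G * M * q ^ n)%R
    with ((3 * G + 2) * G * q ^ n * M)%R by ring.
  apply Rmult_le_compat; try apply Cmod_ge_0.
  + apply qpoch_product_rate; lra.
  + apply BM; unfold annulus, z; rewrite Cmod_cis; lra.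
Qed.

Lemma aw_integral_reduce (q : R) (a b c d : C) :
  (0 < q < 1)%R ->
  (Cmod a < 1)%R -> (Cmod b < 1)%R -> (Cmod c < 1)%R -> (Cmod d < 1)%R ->
  qpoch_inf (a * b * c * d) q * aw_integral q 0 b c d =
  qpoch_inf (a * b) q * qpoch_inf (a * c) q * qpoch_inf (a * d) q *
  aw_integral q a b c d.
Proof.
intros Hq Ha Hb Hc Hd.
apply Clim_unique with
  (fun n => qpoch (a * b * c * d) q n * aw_integral q (a * q ^ n) b c d).
- apply Clim_mult; [now apply qpoch_lim|now apply aw_integral_lim].
- apply Clim_ext with (fun n =>
    qpoch (a * b) q n * qpoch (a * c) q n * qpoch (a * d) q n *
    aw_integral q a b c d).
  + intros n; symmetry; now apply aw_integral_iter.
  + repeat apply Clim_mult; try (now apply qpoch_lim); apply Clim_const.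
Qed.

Lemma aw_integral_rotate (q : R) (a b c d : C) :
  aw_integral q a b c d = aw_integral q b c d a.
Proof.
apply arc_integral_ext; intros t; unfold aw_weight_z, aw_inv_factors; ring.
Qed.

(** One parameter at a time is replaced by 0; the rotation of the parameters brings the next one
    to the front. *)
Lemma aw_integral_product (q : R) (a b c d : C) :
  (0 < q < 1)%R ->
  (Cmod a < 1)%R -> (Cmod b < 1)%R -> (Cmod c < 1)%R -> (Cmod d < 1)%R ->
  qpoch_inf (a * b * c * d) q * aw_integral q 0 0 0 0 =
  qpoch_inf (a * b) q * qpoch_inf (a * c) q * qpoch_inf (a * d) q *
  qpoch_inf (b * c) q * qpoch_inf (b * d) q * qpoch_inf (c * d) q *
  aw_integral q a b c d.
Proof.
intros Hq Ha Hb Hc Hd.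
assert (H0 : (Cmod 0 < 1)%R) by (rewrite Cmod_0; lra).
assert (Ea := aw_integral_reduce q a b c d Hq Ha Hb Hc Hd).
assert (Eb := aw_integral_reduce q b c d 0 Hq Hb Hc Hd H0).
assert (Ec := aw_integral_reduce q c d 0 0 Hq Hc Hd H0 H0).
assert (Ed := aw_integral_reduce q d 0 0 0 Hq Hd H0 H0 H0).
rewrite !Cmult_0_r, qpoch_inf_0 in Eb, Ec, Ed.
rewrite (aw_integral_rotate q 0 b c d) in Ea.
rewrite (aw_integral_rotate q 0 c d 0) in Eb.
rewrite (aw_integral_rotate q 0 d 0 0) in Ec.
transitivity (qpoch_inf (b * c) q * qpoch_inf (b * d) q * qpoch_inf (c * d) q *
  (qpoch_inf (a * b * c * d) q * aw_integral q b c d 0)).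
- transitivity (qpoch_inf (a * b * c * d) q * (qpoch_inf (c * d) q *
    (qpoch_inf (b * c) q * qpoch_inf (b * d) q * 1 * aw_integral q b c d 0)));
    [|ring].
  rewrite <- Eb.
  transitivity (qpoch_inf (a * b * c * d) q *
    (qpoch_inf (c * d) q * 1 * 1 * aw_integral q c d 0 0)); [|ring].
  rewrite <- Ec.
  transitivity (qpoch_inf (a * b * c * d) q *
    (1 * 1 * 1 * aw_integral q d 0 0 0)); [|ring].
  rewrite <- Ed; ring.
- rewrite Ea; ring.
Qed.

(** * The normalizing constant *)

(** Partitions into distinct parts and into odd parts: multiplying by (s^2; s^2)_oo turns the
    left-hand side into (s; s)_oo (-s; s)_oo = (s^2; s^2)_oo. *)
Lemma euler_odd_parts (s : R) :
  (0 < s < 1)%R -> qpoch_inf (- s) s * qpoch_inf s (s * s) = 1.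
Proof.
intros Hs.
assert (Hq : (0 < s * s < 1)%R) by (split; nra).
assert (N : qpoch_inf (s * s) (s * s) <> 0).
{ apply qpoch_inf_neq_0; [exact Hq|].
  rewrite Cmod_mult, Cmod_R, Rabs_pos_eq by lra; lra. }
assert (E1 := qpoch_inf_dissect s s Hs).
assert (E2 := qpoch_inf_square s s Hs).
rewrite <- E1 in E2.
set (A := qpoch_inf (s * s) (s * s)) in *.
transitivity (/ A * (qpoch_inf s (s * s) * A * qpoch_inf (- s) s)).
- field; exact N.
- rewrite E2; field; exact N.
Qed.

(** The evaluation of the integral at (q, -q, s, -s), q = s^2, needs this product in closed form.
    The factors combine in pairs to products with base s, and Euler's identity removes the rest. *)
Lemma qpoch_inf_chebyshev (s : R) :
  (0 < s < 1)%R ->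
  let Q x := qpoch_inf x (s * s) in
  Q (s * s) * (Q (- (s * s * s * s)) * Q (s * s * s) * Q (- (s * s * s)) *
    Q (- (s * s * s)) * Q (s * s * s) * Q (- (s * s))) =
  Q (s * s * s * s * s * s).
Proof.
intros Hs Q.
assert (Hq : (0 < s * s < 1)%R) by (split; nra).
assert (E1 := qpoch_inf_dissect s (s * s) Hs).
assert (E2 := qpoch_inf_dissect s (- (s * s)) Hs).
assert (E3 := qpoch_inf_square s (s * s) Hs).
assert (E4 := qpoch_inf_dissect s (- (s * s * s)) Hs).
assert (E5 := qpoch_inf_shift (s * s) (s * s * s * s) Hq).
assert (E6 := euler_odd_parts s Hs).
rewrite (qpoch_inf_shift s (- s) Hs) in E6.
rewrite (qpoch_inf_shift s (- s * s) Hs) in E6.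
rewrite (qpoch_inf_shift (s * s) s Hq) in E6.
rewrite RtoC_mult in E5, E6.
replace (s * (s * s)) with (s * s * s) in * by ring.
replace (s * (- (s * s))) with (- (s * s * s)) in E2 by ring.
replace (s * (- (s * s * s))) with (- (s * s * s * s)) in E4 by ring.
replace (s * s * (s * s)) with (s * s * s * s) in E3 by ring.
replace (s * s * s * s * (s * s)) with (s * s * s * s * s * s) in E5 by ring.
replace (- s * s * s) with (- (s * s * s)) in E6 by ring.
unfold Q.
rewrite <- E1, <- E2, E5 in E3; rewrite <- E4 in E6.
set (q := (s * s)%R) in *.
set (x6 := qpoch_inf (s * s * s * s * s * s) q) in *.
set (x3 := qpoch_inf (s * s * s) q) in *.
set (y3 := qpoch_inf (- (s * s * s)) q) in *.
set (x2 := qpoch_inf (s * s) q) in *.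
set (y2 := qpoch_inf (- (s * s)) q) in *.
set (y4 := qpoch_inf (- (s * s * s * s)) q) in *.
transitivity (x2 * x3 * (y2 * y3) * (y3 * y4 * x3)); [ring|].
rewrite E3.
transitivity (x6 * ((1 - - s) * ((1 - - s * s) * (y3 * y4)) * ((1 - s) * x3)));
  [ring|rewrite E6; ring].
Qed.

(** The four products in z merge into (q z^2; q)_oo, which cancels against the numerator. *)
Lemma aw_weight_chebyshev (s : R) (z : C) :
  (0 < s < 1)%R -> Cmod z = 1%R ->
  aw_weight_z (s * s) (s * s) (- (s * s)) s (- s) z =
  (1 - z * z) * (1 - / z * / z).
Proof.
intros Hs Hz.
assert (Hq : (0 < s * s < 1)%R) by (split; nra).
assert (Hz0 : z <> 0) by (intros E; rewrite E, Cmod_0 in Hz; lra).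
assert (H : forall w : C, Cmod w = 1%R ->
  qpoch_inf (w * w) (s * s) * (/ qpoch_inf (s * s * w) (s * s) *
    / qpoch_inf (- (s * s) * w) (s * s) * / qpoch_inf (s * w) (s * s) *
    / qpoch_inf (- s * w) (s * s)) = 1 - w * w).
{ intros w Hw.
  assert (Hm : Cmod (s * s) = (s * s)%R)
    by (rewrite <- RtoC_mult, Cmod_R, Rabs_pos_eq; lra).
  assert (Hm' : Cmod s = s) by (rewrite Cmod_R, Rabs_pos_eq; lra).
  assert (E1 := qpoch_inf_dissect s (s * w) Hs).
  assert (E2 := qpoch_inf_dissect s (- s * w) Hs).
  assert (E3 := qpoch_inf_square s (s * w) Hs).
  rewrite (qpoch_inf_shift (s * s) (w * w) Hq).
  replace (s * (s * w)) with (s * s * w) in E1 by ring.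
  replace (s * (- s * w)) with (- (s * s) * w) in E2 by ring.
  replace (- (s * w)) with (- s * w) in E3 by ring.
  replace (s * w * (s * w)) with (w * w * (s * s)%R) in E3
    by (rewrite RtoC_mult; ring).
  rewrite <- E1, <- E2 in E3; rewrite <- E3.
  field; repeat split; apply qpoch_inf_neq_0; trivial;
    rewrite ?Cmod_mult, ?Cmod_opp, Hw, ?Hm, ?Hm'; rewrite <- ?Cmod_mult, ?Hm; lra. }
unfold aw_weight_z, aw_inv_factors, aw_inv_factor.
rewrite <- (H z Hz), <- (H (/ z)).
- ring.
- rewrite Cmod_inv, Hz by exact Hz0; field.
Qed.

Lemma aw_integral_chebyshev (s : R) :
  (0 < s < 1)%R ->
  aw_integral (s * s) (s * s) (- (s * s)) s (- s) = 2 * PI.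
Proof.
intros Hs; apply (is_RInt_unique (V := C_RModule)).
replace (2 * PI) with (@plus C_R_NormedModule ((PI - 0)%R * 2) (- (2) * 0)).
- eapply (is_RInt_ext (V := C_RModule)); [|apply (is_RInt_plus (V := C_RModule));
    [apply is_RInt_Cconst|apply is_RInt_Cmult, (is_RInt_cos_PI 2 0); discriminate]].
  intros t _; cbv beta.
  rewrite aw_weight_chebyshev, cis_inv by (trivial; apply Cmod_cis).
  rewrite <- !cis_plus.
  replace (t + t)%R with ((INR 2 - INR 0) * t)%R by (simpl; ring).
  replace (- t + - t)%R with (- ((INR 2 - INR 0) * t))%R by (simpl; ring).
  set (w := ((INR 2 - INR 0) * t)%R).
  change (2 + - (2) * cos w = (1 - cis w) * (1 - cis (- w))).
  replace ((1 - cis w) * (1 - cis (- w)))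
    with (1 + cis w * cis (- w) - (cis w + cis (- w))) by ring.
  rewrite cis_opp_mult.
  unfold cis, RtoC, Cmult, Cplus, Cminus, Copp, Cplus; simpl.
  rewrite cos_neg, sin_neg; f_equal; ring.
- change ((PI - 0)%R * 2 + - (2) * 0 = 2 * PI).
  rewrite RtoC_minus; ring.
Qed.

(** [aw_integral_product] is read backwards at the parameters where the integral is 2 pi. *)
Lemma aw_integral_zero (q : R) :
  (0 < q < 1)%R -> qpoch_inf q q * aw_integral q 0 0 0 0 = 2 * PI.
Proof.
intros Hq; set (s := sqrt q).
assert (Es : (s * s)%R = q) by (apply sqrt_sqrt; lra).
assert (Hs : (0 < s < 1)%R).
{ split; [apply sqrt_lt_R0; lra|].
  rewrite <- sqrt_1; apply sqrt_lt_1; lra. }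
assert (Hm : (Cmod s < 1)%R) by (rewrite Cmod_R, Rabs_pos_eq; lra).
assert (Hm2 : (Cmod (s * s) < 1)%R) by now apply Cmod_mult_lt_1.
assert (E1 := aw_integral_product q (s * s) (- (s * s)) s (- s) Hq Hm2).
rewrite !Cmod_opp in E1; specialize (E1 Hm2 Hm Hm).
assert (E2 := aw_integral_chebyshev s Hs); rewrite Es in E2.
rewrite E2 in E1.
assert (E3 := qpoch_inf_chebyshev s Hs); cbv zeta in E3; rewrite Es in E3.
replace (s * s * - (s * s) * s * - s) with (s * s * s * s * s * s) in E1 by ring.
replace (s * s * - (s * s)) with (- (s * s * s * s)) in E1 by ring.
replace (s * s * - s) with (- (s * s * s)) in E1 by ring.
replace (- (s * s) * s) with (- (s * s * s)) in E1 by ring.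
replace (- (s * s) * - s) with (s * s * s) in E1 by ring.
replace (s * - s) with (- (s * s)) in E1 by ring.
rewrite <- E3 in E1.
rewrite <- RtoC_mult, Es in E1, E3.
set (P := qpoch_inf (- (q * s * s)) q * qpoch_inf (q * s) q *
  qpoch_inf (- (q * s)) q * qpoch_inf (- (q * s)) q *
  qpoch_inf (q * s) q * qpoch_inf (- q) q) in *.
assert (NP : P <> 0).
{ intros Z; rewrite Z, Cmult_0_r in E3.
  apply (qpoch_inf_neq_0 q (q * s * s * s * s) Hq); [|now symmetry].
  rewrite <- Es, RtoC_mult.
  repeat (apply Cmod_mult_lt_1; [|exact Hm]); exact Hm. }
replace (qpoch_inf q q * aw_integral q 0 0 0 0)
  with (/ P * (qpoch_inf q q * P * aw_integral q 0 0 0 0)) by (field; exact NP).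
rewrite E1; field; exact NP.
Qed.

Theorem askey_wilson_integral (q : R) (a b c d : C) :
  (0 < q < 1)%R ->
  (Cmod a < 1)%R -> (Cmod b < 1)%R -> (Cmod c < 1)%R -> (Cmod d < 1)%R ->
  aw_const q a b c d * aw_integral q a b c d = 1.
Proof.
intros Hq Ha Hb Hc Hd.
assert (E := aw_integral_product q a b c d Hq Ha Hb Hc Hd).
assert (E0 := aw_integral_zero q Hq).
assert (N : qpoch_inf (a * b * c * d) q <> 0).
{ apply qpoch_inf_neq_0; [exact Hq|]; now repeat apply Cmod_mult_lt_1. }
assert (NPI : RtoC PI <> 0).
{ intros E'; injection E'; apply PI_neq0. }
unfold aw_const, qpochs_inf; simpl.
transitivity (/ (2 * PI) * / qpoch_inf (a * b * c * d) q * (qpoch_inf q q *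
 (qpoch_inf (a * b) q * qpoch_inf (a * c) q * qpoch_inf (a * d) q *
  qpoch_inf (b * c) q * qpoch_inf (b * d) q * qpoch_inf (c * d) q *
  aw_integral q a b c d))).
- field; now split.
- rewrite <- E.
  transitivity (/ (2 * PI) * (qpoch_inf q q * aw_integral q 0 0 0 0)).
  + field; now split.
  + rewrite E0; field; exact NPI.
Qed.

Lemma aw_weight_eq (q : R) (a b c d : C) (t : R) :
  (0 < q < 1)%R ->
  (Cmod a < 1)%R -> (Cmod b < 1)%R -> (Cmod c < 1)%R -> (Cmod d < 1)%R ->
  aw_weight q a b c d t = aw_weight_z q a b c d (cis t).
Proof.
intros Hq Ha Hb Hc Hd.
unfold aw_weight, aw_weight_z, aw_inv_factors, aw_inv_factor, qpochs_inf; simpl.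
replace (cis (2 * t)) with (cis t * cis t)
  by (rewrite <- cis_plus; f_equal; ring).
replace (cis (- (2 * t))) with (cis (- t) * cis (- t))
  by (rewrite <- cis_plus; f_equal; ring).
rewrite !cis_inv.
assert (H : forall x, (Cmod x < 1)%R -> forall u, qpoch_inf (x * cis u) q <> 0).
{ intros x Hx u; apply qpoch_inf_neq_0; [exact Hq|].
  rewrite Cmod_mult, Cmod_cis; lra. }
field; repeat split; now apply H.
Qed.

(** * The functional on the basis (az, a/z; q)_n *)

(** Integrability of f (cos theta) against the weight, in the form that is stable under the
    linear operations below. *)
Definition approximable_in_cos (f : C -> C) : Prop :=
  approximable 1 (fun z => f ((z + / z) / 2)).

Lemma aw_functional_eq (q : R) (a b c d : C) (f : C -> C) :
  (0 < q < 1)%R ->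
  (Cmod a < 1)%R -> (Cmod b < 1)%R -> (Cmod c < 1)%R -> (Cmod d < 1)%R ->
  aw_functional q a b c d f = aw_const q a b c d *
    arc_integral (fun z => f ((z + / z) / 2) * aw_weight_z q a b c d z).
Proof.
intros Hq Ha Hb Hc Hd; unfold aw_functional; f_equal.
apply (RInt_ext (V := C_RModule)); intros t _; cbv beta.
rewrite aw_weight_eq by trivial; f_equal; f_equal.
rewrite cis_inv; unfold cis, Cdiv, Cinv, Cmult, Cplus, RtoC; simpl.
rewrite cos_neg, sin_neg; f_equal; field.
Qed.

(** Written as a polynomial in x; [aw_basis_factor] is its product form in z. *)
Fixpoint aw_basis (q : R) (a : C) (n : nat) (x : C) : C :=
  match n with
  | O => 1
  | S m => aw_basis q a m x *
      (1 - 2 * (a * q ^ m) * x + (a * q ^ m) * (a * q ^ m))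
  end.

Lemma aw_basis_factor (q : R) (a z : C) (n : nat) :
  z <> 0 ->
  aw_basis q a n ((z + / z) / 2) = qpoch (a * z) q n * qpoch (a * / z) q n.
Proof.
intros Hz; induction n as [|n IH]; simpl; [ring|].
rewrite IH; field; exact Hz.
Qed.

Lemma aw_functional_basis (q : R) (a b c d : C) (n : nat) :
  (0 < q < 1)%R ->
  (Cmod a < 1)%R -> (Cmod b < 1)%R -> (Cmod c < 1)%R -> (Cmod d < 1)%R ->
  aw_functional q a b c d (aw_basis q a n) =
  qpoch (a * b) q n * qpoch (a * c) q n * qpoch (a * d) q n /
  qpoch (a * b * c * d) q n.
Proof.
intros Hq Ha Hb Hc Hd; rewrite aw_functional_eq by trivial.
rewrite (arc_integral_ext _ (aw_weight_z q (a * q ^ n) b c d)).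
2: { intros t; rewrite aw_basis_factor by apply cis_neq_0.
     symmetry; apply aw_weight_iter; trivial; apply Cmod_cis. }
fold (aw_integral q (a * q ^ n) b c d).
assert (N : qpoch (a * b * c * d) q n <> 0).
{ apply qpoch_neq_0; [exact Hq|]; now repeat apply Cmod_mult_lt_1. }
assert (E := aw_integral_iter q a b c d n Hq Ha Hb Hc Hd).
assert (E1 := askey_wilson_integral q a b c d Hq Ha Hb Hc Hd).
transitivity (aw_const q a b c d * (qpoch (a * b * c * d) q n *
  aw_integral q (a * q ^ n) b c d) / qpoch (a * b * c * d) q n).
- field; exact N.
- rewrite E.
  transitivity (qpoch (a * b) q n * qpoch (a * c) q n * qpoch (a * d) q n *
    (aw_const q a b c d * aw_integral q a b c d) / qpoch (a * b * c * d) q n).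
  + field; exact N.
  + rewrite E1; field; exact N.
Qed.

Lemma aw_functional_ext (q : R) (a b c d : C) (f g : C -> C) :
  (forall x, f x = g x) ->
  aw_functional q a b c d f = aw_functional q a b c d g.
Proof.
intros E; unfold aw_functional; f_equal.
apply (RInt_ext (V := C_RModule)); intros t _; cbv beta; now rewrite E.
Qed.

Lemma aw_functional_scal (q : R) (a b c d k : C) (f : C -> C) :
  (0 < q < 1)%R ->
  (Cmod a < 1)%R -> (Cmod b < 1)%R -> (Cmod c < 1)%R -> (Cmod d < 1)%R ->
  approximable_in_cos f ->
  aw_functional q a b c d (fun x => k * f x) = k * aw_functional q a b c d f.
Proof.
intros Hq Ha Hb Hc Hd Hf; rewrite !aw_functional_eq by trivial.
rewrite (arc_integral_ext _ (fun z =>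
  k * (f ((z + / z) / 2) * aw_weight_z q a b c d z))) by (intros t; ring).
rewrite arc_integral_scal; [ring|].
apply approximable_mult; [lra|exact Hf|now apply approximable_aw_weight].
Qed.

Lemma aw_functional_plus (q : R) (a b c d : C) (f g : C -> C) :
  (0 < q < 1)%R ->
  (Cmod a < 1)%R -> (Cmod b < 1)%R -> (Cmod c < 1)%R -> (Cmod d < 1)%R ->
  approximable_in_cos f -> approximable_in_cos g ->
  aw_functional q a b c d (fun x => f x + g x) =
  aw_functional q a b c d f + aw_functional q a b c d g.
Proof.
intros Hq Ha Hb Hc Hd Hf Hg; rewrite !aw_functional_eq by trivial.
rewrite (arc_integral_ext _ (fun z =>
  f ((z + / z) / 2) * aw_weight_z q a b c d z +
  g ((z + / z) / 2) * aw_weight_z q a b c d z)) by (intros t; ring).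
rewrite arc_integral_plus; [ring| |];
  (apply approximable_mult; [lra|trivial|now apply approximable_aw_weight]).
Qed.

Lemma aw_basis_approximable (q : R) (a : C) (n : nat) :
  approximable_in_cos (aw_basis q a n).
Proof.
apply approximable_ext with (fun z => qpoch (a * z) q n * qpoch (a * / z) q n).
- intros z Hz; symmetry; apply aw_basis_factor.
  apply annulus_neq_0 with 1%R; [lra|exact Hz].
- assert (H1 : (0 < 1)%R) by lra.
  apply approximable_mult; [exact H1| |]; apply approximable_qpoch; trivial.
  + now apply approximable_scal_id.
  + now apply approximable_scal_inv.
Qed.

(** * Formal power series *)

Lemma Csum_S (f : nat -> C) (n : nat) : sum_n f (S n) = sum_n f n + f (S n).
Proof. exact (sum_Sn f n). Qed.

Lemma Csum_first (f : nat -> C) (n : nat) :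
  sum_n f (S n) = f 0%nat + sum_n (fun k => f (S k)) n.
Proof.
induction n as [|n IH]; [rewrite Csum_S, !sum_O; reflexivity|].
rewrite Csum_S, IH, Csum_S; Cring.
Qed.

Lemma Csum_ext (f g : nat -> C) (n : nat) :
  (forall k, (k <= n)%nat -> f k = g k) -> sum_n f n = sum_n g n.
Proof. exact (sum_n_ext_loc f g n). Qed.

Lemma Csum_plus (f g : nat -> C) (n : nat) :
  sum_n (fun k => f k + g k) n = sum_n f n + sum_n g n.
Proof. exact (sum_n_plus f g n). Qed.

Lemma Csum_scal (x : C) (f : nat -> C) (n : nat) :
  sum_n (fun k => x * f k) n = x * sum_n f n.
Proof.
induction n as [|n IH]; [now rewrite !sum_O|].
rewrite !Csum_S, IH; Cring.
Qed.

Lemma Csum_delta (k : C) (u : nat -> C) (n m : nat) :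
  sum_n (fun j => k * (if Nat.eqb j n then RtoC 1 else RtoC 0) * u j) m =
  if Nat.leb n m then k * u n else RtoC 0.
Proof.
induction m as [|m IH].
- rewrite sum_O; destruct n; simpl; Cring.
- rewrite Csum_S, IH.
  destruct (Nat.eqb_spec (S m) n) as [E|E], (Nat.leb_spec n m) as [L|L],
    (Nat.leb_spec n (S m)) as [L'|L']; try lia; try rewrite E; Cring.
Qed.

Lemma Csum_truncate (f : nat -> C) (m n : nat) :
  (forall k, (m < k)%nat -> f k = 0) -> (m <= n)%nat -> sum_n f n = sum_n f m.
Proof.
intros H Hmn; induction Hmn as [|n Hmn IH]; [reflexivity|].
rewrite Csum_S, IH, H by lia; Cring.
Qed.

Definition fps_linear (x : C) : fps := fps_sub fps_one (fps_scal x fps_X).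

Lemma fps_mul_first (f g : fps) (n : nat) :
  fps_mul f g (S n) =
  f 0%nat * g (S n) + sum_n (fun k => f (S k) * g (n - k)%nat) n.
Proof. exact (Csum_first (fun k => f k * g (S n - k)%nat) n). Qed.

Lemma fps_mul_O (f g : fps) : fps_mul f g 0%nat = f 0%nat * g 0%nat.
Proof. unfold fps_mul; rewrite sum_O; reflexivity. Qed.

Lemma fps_mul_left_cancel (f g h : fps) :
  f 0%nat <> 0 -> (forall n, fps_mul f g n = fps_mul f h n) ->
  forall n, g n = h n.
Proof.
intros Hf E n; induction n as [n IH] using lt_wf_ind.
assert (K : forall y z : C, f 0%nat * y = f 0%nat * z -> y = z).
{ intros y z Eyz; replace y with (/ f 0%nat * (f 0%nat * y)) by (field; exact Hf).
  rewrite Eyz; field; exact Hf. }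
apply K; destruct n as [|n].
- rewrite <- !fps_mul_O; apply E.
- assert (En := E (S n)); rewrite !fps_mul_first in En.
  rewrite (Csum_ext (fun k => f (S k) * g (n - k)%nat)
    (fun k => f (S k) * h (n - k)%nat)) in En.
  2: { intros k Hk; rewrite IH by lia; reflexivity. }
  set (T := sum_n (fun k => f (S k) * h (n - k)%nat) n) in En.
  replace (f 0%nat * g (S n)) with (f 0%nat * g (S n) + T - T) by Cring.
  rewrite En; Cring.
Qed.

Lemma fps_mul_linear (f : fps) (x : C) (m : nat) :
  fps_mul f (fps_linear x) (S m) = f (S m) - x * f m.
Proof.
unfold fps_mul; rewrite Csum_S, Nat.sub_diag.
rewrite (Csum_ext _ (fun k => - x * (if Nat.eqb k m then RtoC 1 else RtoC 0) * f k)).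
- rewrite Csum_delta, Nat.leb_refl.
  unfold fps_linear, fps_sub, fps_scal; simpl; Cring.
- intros k Hk; unfold fps_linear, fps_sub, fps_scal.
  destruct (Nat.eqb_spec k m) as [E|E].
  + rewrite E; replace (S m - m)%nat with 1%nat by lia; simpl; Cring.
  + replace (S m - k)%nat with (S (S (m - k - 1))) by lia; simpl; Cring.
Qed.

Lemma fps_mul_linear_O (f : fps) (x : C) : fps_mul f (fps_linear x) 0%nat = f 0%nat.
Proof.
rewrite fps_mul_O; unfold fps_linear, fps_sub, fps_scal; simpl; Cring.
Qed.

(** Associativity of the product, in the one case (f (1 - x u)) g = f ((1 - x u) g) that the
    computation of the inverse uses. *)
Lemma fps_mul_linear_transfer (f g h : fps) (x : C) :
  h 0%nat = g 0%nat -> (forall k, h (S k) = g (S k) - x * g k) ->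
  forall m, fps_mul (fps_mul f (fps_linear x)) g m = fps_mul f h m.
Proof.
intros H0 HS [|n].
- rewrite fps_mul_O, fps_mul_linear_O, fps_mul_O, H0; reflexivity.
- rewrite fps_mul_first, fps_mul_linear_O.
  rewrite (Csum_ext _ (fun k => f (S k) * g (n - k)%nat +
    (- x) * (f k * g (n - k)%nat))).
  2: { intros k _; rewrite fps_mul_linear; Cring. }
  rewrite Csum_plus, Csum_scal, Cplus_assoc, <- fps_mul_first.
  unfold fps_mul; rewrite !Csum_S, Nat.sub_diag, H0.
  rewrite (Csum_ext (fun k => f k * h (S n - k)%nat)
    (fun k => f k * g (S n - k)%nat + (- x) * (f k * g (n - k)%nat))).
  2: { intros k Hk; replace (S n - k)%nat with (S (n - k)) by lia.
       rewrite HS; Cring. }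
  rewrite Csum_plus, Csum_scal; Cring.
Qed.

(** The complete homogeneous symmetric polynomial h_k(y_0, ..., y_{n-1}), by its recurrence; as a
    function of k these are the coefficients of 1 / ((1 - y_0 u) ... (1 - y_{n-1} u)). *)
Fixpoint complete_sym (y : nat -> C) (n : nat) : nat -> C :=
  match n with
  | O => fps_one
  | S m => fix row (k : nat) : C :=
      match k with
      | O => complete_sym y m 0%nat
      | S j => complete_sym y m (S j) + y m * row j
      end
  end.

Lemma complete_sym_S (y : nat -> C) (n k : nat) :
  complete_sym y (S n) (S k) =
  complete_sym y n (S k) + y n * complete_sym y (S n) k.
Proof. reflexivity. Qed.

Lemma complete_sym_O (y : nat -> C) (n : nat) : complete_sym y n 0%nat = 1.
Proof. induction n as [|n IH]; [reflexivity|exact IH]. Qed.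

Lemma fps_prod_complete_sym (y : nat -> C) (n m : nat) :
  fps_mul (fps_prod (fun j => fps_linear (y j)) n) (complete_sym y n) m = fps_one m.
Proof.
revert m; induction n as [|n IH]; intros m.
- destruct m as [|m]; simpl; [rewrite fps_mul_O; simpl; Cring|].
  rewrite fps_mul_first; simpl.
  rewrite Csum_scal; Cring.
- rewrite <- IH; apply fps_mul_linear_transfer.
  + now rewrite !complete_sym_O.
  + intros k; rewrite complete_sym_S; Cring.
Qed.

Lemma fps_inv_prod (y : nat -> C) (n m : nat) :
  fps_inv (fps_prod (fun j => fps_linear (y j)) n) m = complete_sym y n m.
Proof.
set (P := fps_prod (fun j => fps_linear (y j)) n).
assert (HP : P 0%nat <> 0).
{ replace (P 0%nat) with (RtoC 1); [exact C1_nz|].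
  unfold P; induction n as [|n IH]; [reflexivity|].
  simpl; rewrite fps_mul_linear_O; exact IH. }
apply fps_mul_left_cancel with P; [exact HP|]; intros k.
rewrite fps_mul_inv by exact HP; symmetry; apply fps_prod_complete_sym.
Qed.

Lemma fps_mul_monomial (k : C) (g : fps) (n m : nat) :
  fps_mul (fps_scal k (fps_pow fps_X n)) g m =
  if Nat.leb n m then k * g (m - n)%nat else 0.
Proof.
unfold fps_mul, fps_scal; rewrite <- Csum_delta with (u := fun j => g (m - j)%nat).
apply Csum_ext; intros j _; now rewrite fps_pow_X.
Qed.

(** * Newton interpolation *)

Fixpoint newton (y : nat -> C) (n : nat) (x : C) : C :=
  match n with
  | O => 1
  | S m => newton y m x * (x - y m)
  end.

(** Induction on m with x N_n = N_{n+1} + y_n N_n for the Newton polynomials N_n: the coefficient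
    of N_n becomes h(n-1, m+1-n) + y_n h(n, m-n), which is the recurrence of [complete_sym];
    here h(n, k) = h_k(y_0, ..., y_n). *)
Lemma newton_expansion (y : nat -> C) (x : C) (m : nat) :
  x ^ m = sum_n (fun n => complete_sym y (S n) (m - n) * newton y n x) m.
Proof.
induction m as [|m IH].
- rewrite sum_O; simpl; Cring.
- assert (E : sum_n (fun n => complete_sym y n (S m - n) * newton y n x) (S m) =
    sum_n (fun n => complete_sym y (S n) (m - n) * newton y (S n) x) m).
  { rewrite Csum_first; simpl (complete_sym y 0 _); simpl (fps_one _).
    rewrite Cmult_0_l, Cplus_0_l; reflexivity. }
  rewrite Csum_S, Nat.sub_diag in E.
  rewrite Csum_S, Nat.sub_diag.
  rewrite (Csum_ext _ (fun n => complete_sym y n (S m - n) * newton y n x +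
    y n * (complete_sym y (S n) (m - n) * newton y n x))).
  2: { intros n Hn; replace (S m - n)%nat with (S (m - n)) by lia.
       rewrite complete_sym_S; Cring. }
  rewrite Csum_plus, complete_sym_O, <- (complete_sym_O y (S m)).
  rewrite (Cplus_comm (sum_n _ m) (sum_n _ m)), <- Cplus_assoc, E, <- Csum_plus.
  rewrite Cpow_S, IH, <- Csum_scal.
  apply Csum_ext; intros n _; simpl; Cring.
Qed.

(** 1 - 2 a q^k x + a^2 q^{2k} = - 2 a q^k (x - a_k) at the nodes a_k of [aw_node], and the
    exponents of q add up to n (n - 1) / 2. *)
Lemma newton_aw_basis (q : R) (a x : C) (n : nat) :
  (0 < q)%R -> a <> 0 ->
  newton (aw_node q a) n x =
  (- (1)) ^ n / (2 * a) ^ n / q ^ (n * (n - 1) / 2) * aw_basis q a n x.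
Proof.
intros Hq Ha.
assert (Hq0 : RtoC q <> 0) by (intros E; injection E; lra).
induction n as [|n IH]; [simpl; field; exact C1_nz|].
replace (S n * (S n - 1) / 2)%nat with (n * (n - 1) / 2 + n)%nat.
2: { replace (S n * (S n - 1))%nat with (n * (n - 1) + n * 2)%nat
       by (destruct n; simpl; nia).
     rewrite Nat.div_add by lia; reflexivity. }
simpl newton; simpl aw_basis; rewrite IH, Cpow_add_r, !Cpow_S.
unfold aw_node.
assert (H1 := Cpow_nz q n Hq0).
assert (H2 := Cpow_nz q (n * (n - 1) / 2) Hq0).
assert (H3 : (2 * a) ^ n <> 0).
{ apply Cpow_nz, Cmult_neq_0; [|exact Ha]; intros E; injection E; lra. }
field; repeat split; trivial.
Qed.

Lemma aw_functional_sum (q : R) (a b c d : C) (k : nat -> C)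
    (p : nat -> C -> C) (m : nat) :
  (0 < q < 1)%R ->
  (Cmod a < 1)%R -> (Cmod b < 1)%R -> (Cmod c < 1)%R -> (Cmod d < 1)%R ->
  (forall n, approximable_in_cos (p n)) ->
  aw_functional q a b c d (fun x => sum_n (fun n => k n * p n x) m) =
  sum_n (fun n => k n * aw_functional q a b c d (p n)) m.
Proof.
intros Hq Ha Hb Hc Hd Hp.
assert (H1 : (0 < 1)%R) by lra.
assert (Hk : forall n, approximable_in_cos (fun x => k n * p n x)).
{ intros n; apply approximable_mult; [exact H1|apply approximable_const|apply Hp]. }
assert (HS : forall n,
  approximable_in_cos (fun x => sum_n (fun j => k j * p j x) n)).
{ induction n as [|n IH].
  - apply approximable_ext with (2 := Hk 0%nat); intros z _; now rewrite sum_O.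
  - apply approximable_ext with (2 := approximable_plus 1 _ _ IH (Hk (S n))).
    intros z _; symmetry; apply Csum_S. }
induction m as [|m IH].
- rewrite sum_O, <- aw_functional_scal by trivial.
  apply aw_functional_ext; intros x; now rewrite sum_O.
- rewrite Csum_S, <- IH, <- aw_functional_scal, <- aw_functional_plus by trivial.
  apply aw_functional_ext; intros x; apply Csum_S.
Qed.

Theorem theorem17 (q : R) (a b c d : C)
    (hq : (0 < q < 1)%R) (ha : a <> 0)
    (habcd : (Rmax (Rmax (Cmod a) (Cmod b)) (Rmax (Cmod c) (Cmod d)) < 1)%R) :
  is_fps_sum
    (fun n : nat =>
       fps_scal (qpochs (a * b :: a * c :: a * d :: nil) q n /
                 qpoch (a * b * c * d) q n)
         (fps_div
            (fps_scal ((- (1)) ^ n / (2 * a) ^ n / q ^ (n * (n - 1) / 2))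
               (fps_pow fps_X n))
            (fps_prod
               (fun j => fps_sub fps_one (fps_scal (aw_node q a j) fps_X))
               (S n))))
    (fun n : nat => aw_functional q a b c d (fun x : C => x ^ n)).
Proof.
apply Rmax_Rlt in habcd; destruct habcd as [Hab Hcd].
apply Rmax_Rlt in Hab; destruct Hab as [Ha Hb].
apply Rmax_Rlt in Hcd; destruct Hcd as [Hc Hd].
intros m; exists m; intros n Hn.
rewrite (Csum_truncate _ m n); [|intros k Hk|exact Hn].
2: { unfold fps_scal at 1, fps_div; rewrite fps_mul_monomial.
     rewrite (proj2 (Nat.leb_gt k m)) by exact Hk; Cring. }
set (K := fun k => (- (1)) ^ k / (2 * a) ^ k / q ^ (k * (k - 1) / 2)).
rewrite (aw_functional_ext q a b c d _ (fun x => sum_n (fun k =>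
  complete_sym (aw_node q a) (S k) (m - k) * K k * aw_basis q a k x) m)).
2: { intros x; rewrite (newton_expansion (aw_node q a) x m).
     apply Csum_ext; intros k _; rewrite newton_aw_basis by (trivial; lra).
     unfold K; Cring. }
rewrite (aw_functional_sum q a b c d
  (fun k => complete_sym (aw_node q a) (S k) (m - k) * K k)) by
  (trivial; intros k; apply aw_basis_approximable).
apply Csum_ext; intros k Hk.
unfold fps_scal at 1, fps_div; rewrite fps_mul_monomial.
rewrite (proj2 (Nat.leb_le k m)) by exact Hk.
change (fps_prod _ (S k))
  with (fps_prod (fun j => fps_linear (aw_node q a j)) (S k)).
rewrite fps_inv_prod, aw_functional_basis by trivial.
unfold qpochs, Cdiv; simpl map; simpl fold_right; unfold K, Cdiv; Cring.
Qed.
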